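(* Assume that the tensor $C$ satisfies the stated assumptions (symmetric, isotropic, homogeneous and positive), that $f\in C([0,T];L^2(\Omega;\mathbb{R}^d))$, $g\in C([0,T];H^1(\Omega;\mathbb{R}^d))$, $q\in C([0,T];L^2(\Gamma_1;\mathbb{R}^d))$, $\phi^0\in L^2(\Omega;\mathbb{R}^{d\times d}_{\rm sym})$, and that $f,g,q$ are independent of time, i.e. $\partial f/\partial t=0$, $\partial g/\partial t=0$, $\partial q/\partial t=0$. Suppose that $(u,\phi)\in C^1([0,T];X\times\Psi)$ is a solution to the weak problem: $(u(t),\phi(t))\in V(g)\times\Psi$ for $t\in(0,T)$, $\phi(0)=\phi^0$, and for all $t\in(0,T)$ $$(\sigma[u(t),\phi(t)],e[v])_\Psi=\ell(v)\quad\forall v\in V,\qquad \eta\frac{\partial\phi}{\partial t}(t)+\alpha\phi(t)-\sigma[u(t),\phi(t)]=0\ \text{ in }\Psi.$$ Then for any $t\in(0,T)$: (i) (Gradient flow structure) $$\Bigl(\eta\frac{\partial\phi}{\partial t}(t),\psi\Bigr)_\Psi=-(\partial E_\ast)(\phi(t))[\psi]\quad\forall\psi\in\Psi.$$ (ii) (Energy decay estimate) $$\frac{d}{dt}E(u(t),\phi(t))=-\eta\Bigl\|\frac{\partial\phi}{\partial t}(t)\Bigr\|_\Psi^2\le 0.$$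
   Context: Let $d\in\{2,3\}$, $T>0$, and let $\Omega\subset\mathbb{R}^d$ be a bounded Lipschitz domain with boundary $\Gamma=\partial\Omega$. $\Gamma_0$ is an open subset of $\Gamma$ whose $(d-1)$-dimensional measure is positive and equal to that of $\overline{\Gamma}_0$, and $\Gamma_1=\Gamma\setminus\overline{\Gamma}_0$ (the case $\Gamma_0=\Gamma$, $\Gamma_1=\emptyset$ is allowed). $\eta>0$ and $\alpha\ge0$ are constants. $\mathbb{R}^{d\times d}_{\rm sym}$ is the space of real symmetric $d\times d$ matrices; $A:B=\sum_{i,j}A_{ij}B_{ij}$. Tensor $C=(c_{ijkl})$: $c_{ijkl}=\lambda\delta_{ij}\delta_{kl}+\mu(\delta_{ik}\delta_{jl}+\delta_{il}\delta_{jk})$ with constants $\lambda,\mu\in\mathbb{R}$, and there is $c_\ast>0$ with $\sum_{i,j,k,l}c_{ijkl}\xi_{ij}\xi_{kl}\ge c_\ast|\xi|^2$ for all $\xi\in\mathbb{R}^{d\times d}_{\rm sym}$, where $|\xi|^2=\sum_{i,j}\xi_{ij}^2$. It acts by $(C\xi)_{ij}=\sum_{k,l}c_{ijkl}\xi_{kl}$. Notation: $e[u]=\frac12[\nabla u+(\nabla u)^T]$, $\sigma[u,\phi]=C(e[u]-\phi)$. $X=H^1(\Omega;\mathbb{R}^d)$; $V(g)=\{v\in X: v|_{\Gamma_0}=g|_{\Gamma_0}\}$ (traces); $V=V(0)$; $\Psi=L^2(\Omega;\mathbb{R}^{d\times d}_{\rm sym})$. $(\phi,\psi)_\Psi=\int_\Omega\phi:\psi\,dx$,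 $(\phi,\psi)_C=(C\phi,\psi)_\Psi$, with norms $\|\cdot\|_\Psi$, $\|\cdot\|_C$. $(\cdot,\cdot)$ is the inner product of $L^2(\Omega;\mathbb{R}^d)$. The linear form is $\ell(v)=(f,v)+\int_{\Gamma_1}q\cdot v\,ds$ (independent of $t$ since $f,q$ are). Energy: $E(u,\phi)=\frac12\|e[u]-\phi\|_C^2+\frac{\alpha}{2}\|\phi\|_\Psi^2-\ell(u)$ for $(u,\phi)\in V(g)\times\Psi$. Reduced energy: $E_\ast(\psi)=\min_{v\in V(g)}E(v,\psi)$ for $\psi\in\Psi$, with Gâteaux derivative $(\partial E_\ast)(\phi)[\psi]=\frac{d}{d\varepsilon}E_\ast(\phi+\varepsilon\psi)|_{\varepsilon=0}$. *)

(* Defs.v *)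
From HB Require Import structures.
From mathcomp Require Import all_boot all_order all_algebra.
From mathcomp Require Import all_classical all_reals all_analysis.

Set Implicit Arguments.
Unset Strict Implicit.
Unset Printing Implicit Defensive.

Import Order.TTheory GRing.Theory Num.Theory.
Import numFieldNormedType.Exports.

Local Open Scope classical_set_scope.
Local Open Scope ring_scope.

(* Points and vectors of R^d are row vectors 'rV[R]_d = 'M[R]_(1, d), so the   *)
(* Frobenius product below is both the dot product and A : B. The topology of *)
(* 'rV[R]_d comes from the sup norm; everything metric uses the Euclidean one. *)

Definition mdot (R : realType) m n (A B : 'M[R]_(m, n)) : R :=
  \sum_i \sum_j A i j * B i j.

Definition enorm (R : realType) m n (A : 'M[R]_(m, n)) : R :=
  Num.sqrt (mdot A A).

Definition eball (R : realType) d (x : 'rV[R]_d) (r : R) : set 'rV[R]_d :=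
  [set y | enorm (y - x) < r].

(* All subsets of R^d are measurable in this type, so that mu_ext over it is   *)
(* the outer measure obtained from covers by arbitrary sets.                   *)
Definition all_sets (R : realType) d : Type :=
  g_sigma_algebraType [set: set 'rV[R]_d].

Definition box (R : realType) d (a b : 'rV[R]_d) : set 'rV[R]_d :=
  [set x | forall i, a 0 i <= x 0 i < b 0 i].

(* +oo on the nonempty sets that are not boxes. *)
Definition box_weight (R : realType) d (A : set (all_sets R d)) : \bar R :=
  if A == set0 then 0%E else
  ereal_inf [set (\prod_i (p.2 0 i - p.1 0 i))%:E
            | p in [set p : 'rV[R]_d * 'rV[R]_d |
                    (forall i, p.1 0 i <= p.2 0 i) /\ A = box p.1 p.2]].

Lemma box_weight0 (R : realType) d : box_weight (set0 : set (all_sets R d)) = 0%E.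
Proof. by rewrite /box_weight eqxx. Qed.

Lemma box_weight_ge0 (R : realType) d (A : set (all_sets R d)) :
  (0 <= box_weight A)%E.
Proof.
rewrite /box_weight; case: ifPn => // _.
apply: le_ereal_inf_tmp => _ [p [ple _] <-].
by rewrite lee_fin prodr_ge0// => i _; rewrite subr_ge0.
Qed.

Definition leb (R : realType) d : set 'rV[R]_d -> \bar R :=
  mu_ext (@box_weight R d).

HB.instance Definition _ (R : realType) d :=
  isOuterMeasure.Build R 'rV[R]_d (@leb R d)
    (mu_ext0 (@box_weight0 R d) (@box_weight_ge0 R d))
    (mu_ext_ge0 (@box_weight_ge0 R d))
    (le_mu_ext (@box_weight R d))
    (mu_ext_sigma_subadditive (@box_weight_ge0 R d)).

Definition diam (R : realType) d (A : set 'rV[R]_d) : \bar R :=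
  ereal_sup (0%E |` [set (enorm (p.1 - p.2))%:E | p in A `*` A]).

(* The factor is the volume of the unit ball of R^k, which makes the measure   *)
(* the usual surface measure on k-dimensional Lipschitz surfaces.              *)
Definition diam_weight (R : realType) d (k : nat) (delta : R)
    (A : set (all_sets R d)) : \bar R :=
  if A == set0 then 0%E else
  if (diam A <= delta%:E)%E
  then (leb [set y : 'rV[R]_k | (enorm y <= 1)%R] * ((2^-1)%R%:E * diam A) ^+ k)%E
  else +oo%E.

Lemma diam_weight0 (R : realType) d k (delta : R) :
  diam_weight k delta (set0 : set (all_sets R d)) = 0%E.
Proof. by rewrite /diam_weight eqxx. Qed.

Lemma diam_weight_ge0 (R : realType) d k (delta : R) (A : set (all_sets R d)) :
  (0 <= diam_weight k delta A)%E.
Proof.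
rewrite /diam_weight; case: ifPn => // _; case: ifPn => // _.
apply: mule_ge0; first exact: outer_measure_ge0.
apply: expe_ge0; apply: mule_ge0; first by rewrite lee_fin invr_ge0.
by apply: ereal_sup_ubound; left.
Qed.

Definition hausdorff (R : realType) d (k : nat) (A : set 'rV[R]_d) : \bar R :=
  ereal_sup [set mu_ext (@diam_weight R d k delta) A
            | delta in [set delta : R | 0 < delta]].

Section hausdorff_outer.
Variables (R : realType) (d k : nat).
Local Open Scope ereal_scope.

Lemma hausdorff_ge0 (A : set 'rV[R]_d) : 0 <= hausdorff k A.
Proof.
apply: (@le_trans _ _ (mu_ext (@diam_weight R d k 1%R) A)).
  exact: mu_ext_ge0 (@diam_weight_ge0 R d k 1%R) _.
by apply: ereal_sup_ubound; exists 1%R => //=; exact: ltr01.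
Qed.

Lemma hausdorff0 : hausdorff k (set0 : set 'rV[R]_d) = 0.
Proof.
apply/eqP; rewrite eq_le hausdorff_ge0 andbT.
apply: ge_ereal_sup => _ [delta _ <-].
by rewrite (mu_ext0 (@diam_weight0 R d k delta) (@diam_weight_ge0 R d k delta)).
Qed.

Lemma le_hausdorff :
  {homo @hausdorff R d k : A B / A `<=` B >-> A <= B}.
Proof.
move=> A B AB; apply: ge_ereal_sup => _ [delta delta0 <-].
apply: (le_trans (le_mu_ext (@diam_weight R d k delta) AB)).
by apply: ereal_sup_ubound; exists delta.
Qed.

Lemma hausdorff_sigma_subadditive : sigma_subadditive (@hausdorff R d k).
Proof.
move=> F; apply: ge_ereal_sup => _ [delta delta0 <-].
apply: (le_trans (mu_ext_sigma_subadditive (@diam_weight_ge0 R d k delta) F)).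
apply: lee_nneseries => [i _ _|i _].
  exact: mu_ext_ge0 (@diam_weight_ge0 R d k delta) _.
by apply: ereal_sup_ubound; exists delta.
Qed.

HB.instance Definition _ := isOuterMeasure.Build R 'rV[R]_d (@hausdorff R d k)
  hausdorff0 hausdorff_ge0 le_hausdorff hausdorff_sigma_subadditive.

End hausdorff_outer.

(* Measurability below is with respect to the Caratheodory sigma-algebras. *)
Definition leb_outer (R : realType) d : {outer_measure set 'rV[R]_d -> \bar R} :=
  @leb R d.

Definition surface_outer (R : realType) d :
    {outer_measure set 'rV[R]_d -> \bar R} :=
  @hausdorff R d d.-1.

Definition Lebesgue (R : realType) d :
    {measure set (caratheodory_type (leb_outer R d)) -> \bar R} :=
  (leb_outer R d : set (caratheodory_type (leb_outer R d)) -> \bar R).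

Definition Surface (R : realType) d :
    {measure set (caratheodory_type (surface_outer R d)) -> \bar R} :=
  (surface_outer R d : set (caratheodory_type (surface_outer R d)) -> \bar R).

Definition bdry (R : realType) d (Omega : set 'rV[R]_d) : set 'rV[R]_d :=
  closure Omega `\` Omega°.

(* Near each boundary point x, Omega is the part of a ball lying strictly      *)
(* above a Lipschitz graph over the hyperplane orthogonal to a unit vector e;  *)
(* y - <y, e> e is the projection of y to that hyperplane, so no rotation of   *)
(* the coordinates is needed.                                                  *)
Definition lipschitz_boundary (R : realType) d (Omega : set 'rV[R]_d) : Prop :=
  forall x, bdry Omega x ->
  exists (r : R) (e : 'rV[R]_d) (h : 'rV[R]_d -> R) (L : R),
    [/\ 0 < r, enorm e = 1,
        forall y z, `|h y - h z| <= L * enorm (y - z)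
      & forall y, eball x r y ->
          (Omega y <-> h (y - mdot y e *: e) < mdot y e)].

Definition bounded_lipschitz_domain (R : realType) d (Omega : set 'rV[R]_d) :=
  [/\ open Omega, connected Omega, Omega !=set0, bounded_set Omega
    & lipschitz_boundary Omega].

(* Functions stand for their classes modulo equality a.e. on D. *)
Section L2.
Context (R : realType) (disp : measure_display) (T : measurableType disp).
Variables (mu : {measure set T -> \bar R}) (D : set T) (m n : nat).
Implicit Types v w : T -> 'M[R]_(m, n).

Definition L2 v : Prop := forall i j,
  measurable_fun D (fun x => v x i j) /\
  mu.-integrable D (fun x => ((v x i j) ^+ 2)%:E).

Definition L2dot v w : R := \int[mu]_(x in D) mdot (v x) (w x).

Definition L2norm v : R := Num.sqrt (L2dot v v).

Definition eq_ae_on v w : Prop := {ae mu, forall x, D x -> v x = w x}.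

End L2.

Arguments L2 {R disp T} mu D {m n} v.
Arguments L2norm {R disp T} mu D {m n} v.

Definition Psi (R : realType) d (Omega : set 'rV[R]_d)
    (psi : 'rV[R]_d -> 'M[R]_d) : Prop :=
  L2 (Lebesgue R d) Omega psi /\
  {ae Lebesgue R d, forall x, Omega x -> (psi x)^T = psi x}.

Definition iter_partial (R : realType) d (s : seq 'I_d) (theta : 'rV[R]_d -> R) :
    'rV[R]_d -> R :=
  foldr (fun j h => 'D_(delta_mx 0 j : 'rV[R]_d) h) theta s.

Definition smooth (R : realType) d (theta : 'rV[R]_d -> R) : Prop :=
  forall s : seq 'I_d,
    continuous (iter_partial s theta) /\
    forall j x, derivable (iter_partial s theta) x (delta_mx 0 j).

Definition test_function (R : realType) d (Omega : set 'rV[R]_d)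
    (theta : 'rV[R]_d -> R) : Prop :=
  [/\ smooth theta, compact (closure [set x | theta x != 0])
    & closure [set x | theta x != 0] `<=` Omega].

(* G x i j is the weak derivative of the i-th component of v along x_j. *)
Definition weak_gradient (R : realType) d (Omega : set 'rV[R]_d)
    (v : 'rV[R]_d -> 'rV[R]_d) (G : 'rV[R]_d -> 'M[R]_d) : Prop :=
  forall (theta : 'rV[R]_d -> R), test_function Omega theta ->
  forall i j : 'I_d,
    \int[Lebesgue R d]_(x in Omega) (v x 0 i * 'D_(delta_mx 0 j) theta x) =
    - \int[Lebesgue R d]_(x in Omega) (G x i j * theta x).

(* An element of H^1 is carried together with its weak gradient, i.e. as the   *)
(* pair (v, grad v) of the graph of the weak gradient in L^2 x L^2. Since weak *)
(* gradients are unique a.e., this is the space H^1 itself, and the norm below *)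
(* is the H^1 norm.                                                            *)
Definition vfield (R : realType) d : Type :=
  (('rV[R]_d -> 'rV[R]_d) * ('rV[R]_d -> 'M[R]_d))%type.

Definition H1 (R : realType) d (Omega : set 'rV[R]_d) (v : vfield R d) : Prop :=
  [/\ L2 (Lebesgue R d) Omega v.1, L2 (Lebesgue R d) Omega v.2
    & weak_gradient Omega v.1 v.2].

Definition H1norm (R : realType) d (Omega : set 'rV[R]_d) (v : vfield R d) : R :=
  Num.sqrt (L2norm (Lebesgue R d) Omega v.1 ^+ 2 +
            L2norm (Lebesgue R d) Omega v.2 ^+ 2).

Definition strain (R : realType) d (v : vfield R d) : 'rV[R]_d -> 'M[R]_d :=
  fun x => 2^-1 *: (v.2 x + (v.2 x)^T).

(* tau is the trace of v on the boundary: it is in L^2(Gamma) and, for         *)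
(* H^{d-1}-almost every boundary point x, tau x is the approximate limit at x  *)
(* of v from inside Omega,                                                     *)
(*   |B(x,r) /\ Omega|^-1 \int_(B(x,r) /\ Omega) |v(y) - tau(x)| dy --> 0.     *)
(* Every v in H^1 of a bounded Lipschitz domain has exactly one such tau,      *)
(* modulo equality a.e. (Evans-Gariepy, Measure Theory and Fine Properties of  *)
(* Functions, Section 5.3; Ambrosio-Fusco-Pallara, Theorem 3.87).              *)
Definition is_trace (R : realType) d (Omega : set 'rV[R]_d)
    (v tau : 'rV[R]_d -> 'rV[R]_d) : Prop :=
  L2 (Surface R d) (bdry Omega) tau /\
  {ae Surface R d, forall x : 'rV[R]_d, bdry Omega x ->
    (fun r : R => (fine (leb (eball x r `&` Omega)))^-1 *
       \int[Lebesgue R d]_(y in eball x r `&` Omega) enorm (v y - tau x))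
    @ 0^'+ --> (0 : R)}.

(* A representative of the trace, which is_trace determines only a.e. *)
Definition trace (R : realType) d (Omega : set 'rV[R]_d)
    (v : 'rV[R]_d -> 'rV[R]_d) : 'rV[R]_d -> 'rV[R]_d :=
  xget (fun=> 0) (is_trace Omega v).

(* The existence of the two traces is automatic on a bounded Lipschitz domain.  *)
Definition Vspace (R : realType) d (Omega Gamma0 : set 'rV[R]_d)
    (g : vfield R d) : set (vfield R d) :=
  [set v | H1 Omega v /\
     exists tv tg, [/\ is_trace Omega v.1 tv, is_trace Omega g.1 tg
                     & eq_ae_on (Surface R d) Gamma0 tv tg]].

Definition elast (R : realType) d (lam mu : R) (i j k l : 'I_d) : R :=
  lam * (i == j)%:R * (k == l)%:R +
  mu * ((i == k)%:R * (j == l)%:R + (i == l)%:R * (j == k)%:R).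

Definition elast_positive (R : realType) d (lam mu : R) : Prop :=
  exists cstar : R, 0 < cstar /\
    forall xi : 'M[R]_d, xi^T = xi ->
      cstar * enorm xi ^+ 2 <=
      \sum_i \sum_j \sum_k \sum_l elast lam mu i j k l * xi i j * xi k l.

Definition elast_act (R : realType) d (lam mu : R) (xi : 'M[R]_d) : 'M[R]_d :=
  \matrix_(i, j) \sum_k \sum_l elast lam mu i j k l * xi k l.

Definition stress (R : realType) d (lam mu : R) (v : vfield R d)
    (psi : 'rV[R]_d -> 'M[R]_d) : 'rV[R]_d -> 'M[R]_d :=
  fun x => elast_act lam mu (strain v x - psi x).

Definition Cnorm (R : realType) d (lam mu : R) (Omega : set 'rV[R]_d)
    (psi : 'rV[R]_d -> 'M[R]_d) : R :=
  Num.sqrt (L2dot (Lebesgue R d) Omega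
              (fun x => elast_act lam mu (psi x)) psi).

Definition load (R : realType) d (Omega Gamma1 : set 'rV[R]_d)
    (f q : 'rV[R]_d -> 'rV[R]_d) (v : vfield R d) : R :=
  L2dot (Lebesgue R d) Omega f v.1 +
  L2dot (Surface R d) Gamma1 q (trace Omega v.1).

Definition energy (R : realType) d (lam mu alpha : R)
    (Omega Gamma1 : set 'rV[R]_d) (f q : 'rV[R]_d -> 'rV[R]_d)
    (v : vfield R d) (psi : 'rV[R]_d -> 'M[R]_d) : R :=
  2^-1 * Cnorm lam mu Omega (strain v - psi) ^+ 2 +
  alpha / 2 * L2norm (Lebesgue R d) Omega psi ^+ 2 -
  load Omega Gamma1 f q v.

(* E_*(psi), the minimum over V(g), is taken as the greatest lower bound of    *)
(* the energies, which is attained by Korn's inequality.                       *)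
Definition reduced_energy (R : realType) d (lam mu alpha : R)
    (Omega Gamma0 Gamma1 : set 'rV[R]_d) (f q : 'rV[R]_d -> 'rV[R]_d)
    (g : vfield R d) (psi : 'rV[R]_d -> 'M[R]_d) : R :=
  inf [set energy lam mu alpha Omega Gamma1 f q v psi
      | v in Vspace Omega Gamma0 g].

(* (d/d eps) F (phi + eps psi) at eps = 0; existence is stated separately by   *)
(* gateaux_derivable.                                                          *)
Definition gateaux_derivable (R : realType) (W : lmodType R) (F : W -> R)
    (phi psi : W) : Prop :=
  derivable (fun eps : R => F (phi + eps *: psi)) 0 1.

Definition gateaux (R : realType) (W : lmodType R) (F : W -> R)
    (phi psi : W) : R :=
  derive1 (fun eps : R => F (phi + eps *: psi)) 0.

(* Paths [0, T] -> E, where E is a subset of W seminormed by N; limits are taken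
   within [0, T], so they are one-sided at the endpoints. *)
Section paths.
Context (R : realType) (W : lmodType R).
Variables (E : W -> Prop) (N : W -> R) (T : R).
Implicit Types w dw : R -> W.

Definition C0_path w : Prop := forall t, t \in `[0, T] ->
  E (w t) /\
  (fun s => N (w s - w t)) @ within `[0, T] (nbhs t) --> (0 : R).

Definition time_derivative w dw : Prop := forall t, t \in `[0, T] ->
  (fun s => N ((s - t)^-1 *: (w s - w t) - dw t))
    @ within `[0, T] (t^') --> (0 : R).

Definition C1_path w dw : Prop :=
  [/\ C0_path w, C0_path dw & time_derivative w dw].

End paths.

(* Main.v *)
Require Import Defs.
From mathcomp Require Import all_boot all_order all_algebra.
From mathcomp Require Import all_classical all_reals all_analysis.
From mathcomp Require Import measurable_realfun.
From mathcomp Require Import ring lra.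

(** No trace inequality and no Korn inequality is needed. A trace is
    determined a.e. by averages over balls, so it is linear on the differences
    of elements of V(g), and these belong to V(0). If u solves the weak equation
    for phi, expanding the quadratic energy and testing with v - u gives, for
    every v in V(g) and every phi', with delta = phi' - phi,
      E(v, phi') = E(u, phi) - eta (dphi, delta)
        + 1/2 |e[v - u] - delta|_C^2 + alpha/2 |delta|^2.
    With delta = h psi the last two terms are nonnegative, and O(h^2) for
    v = u, so that the infimum over v gives (i). With v = u(s), phi' = phi(s)
    they are O((s - t)^2), which gives (ii): testing with u(s) - u(t) instead of
    du/dt(t) avoids the closedness of V(0). *)

Set Implicit Arguments.
Unset Strict Implicit.
Unset Printing Implicit Defensive.

Import Order.TTheory GRing.Theory Num.Theory.
Import numFieldNormedType.Exports.

Local Open Scope classical_set_scope.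
Local Open Scope ring_scope.

(** * Lebesgue and Hausdorff measures of open sets *)

(** The measures are concrete outer measures built from covers, so what integration needs is proved
    by hand: open sets are Caratheodory-measurable for both, and Lebesgue measure is finite on
    bounded sets and positive on nonempty open ones. Positivity serves the traces: the mean of a
    constant field [c] over the part of a ball inside [Omega] is then [enorm c], so a trace of the
    zero field vanishes a.e., and by subtraction traces are unique. The second obstacle is that
    functions stand for their classes. Norms are only seminorms on a set closed under linear
    combinations, [trace] chooses a representative for each field separately, and time-independence
    makes [f s] and [f t] equal only almost everywhere. Hence the a.e.-invariance lemmas for
    pairings, loads and [Vspace], by which the expansion at time [t] applies to the state at time
    [s]. *)

Lemma mu_ext_split disp (T : measurableType disp) (R : realType)
    (w : set T -> \bar R) (P Q : set T) :
  measurable P -> measurable Q -> (forall A, 0 <= w A)%E ->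
  (forall A, w (A `&` P) + w (A `&` Q) <= w A)%E ->
  forall X, (mu_ext w (X `&` P) + mu_ext w (X `&` Q) <= mu_ext w X)%E.
Proof.
move=> mP mQ w0 wPQ X; apply: le_ereal_inf_tmp => _ [F [mF XF] <-].
(* Cutting each set of the cover by [P] and by [Q] covers both parts, so the inequality for single
   sets can be summed over the cover. *)
have split_le B : measurable B ->
    (mu_ext w (X `&` B) <= \sum_(k <oo) w (F k `&` B))%E.
  move=> mB; apply: ereal_inf_lbound; exists (fun k => F k `&` B) => //.
  split=> [k|]; first exact: measurableI.
  by rewrite -setI_bigcupl; exact: setSI.
apply: (le_trans (leeD (split_le _ mP) (split_le _ mQ))).
rewrite -nneseriesD//; apply: lee_nneseries => // k _ _.
exact: adde_ge0.
Qed.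

Lemma all_sets_measurable (R : realType) d (A : set (all_sets R d)) :
  measurable A.
Proof. exact: sub_sigma_algebra. Qed.

Lemma mu_ext_le (R : realType) d (w : set (all_sets R d) -> \bar R) A :
  w set0 = 0%E -> (forall B, 0 <= w B)%E -> (mu_ext w A <= w A)%E.
Proof.
move=> w0 wge0; apply: ereal_inf_lbound.
exists (fun k => if k == 0%N then A else set0).
  by split=> [k|x Ax]; [exact: all_sets_measurable|exists 0%N].
by rewrite nneseries_recl// eseries0 ?adde0// => -[|i].
Qed.

(** Balls of the sup norm are cubes, so cubes with rational centre and radius [n.+1%:R^-1] form a
    countable base. *)
Lemma open_rat_box (R : realType) d (A : set 'rV[R]_d) x : open A -> A x ->
  exists (q : 'rV[rat]_d) (n : nat),
    (forall i, `|x 0 i - ratr (q 0 i)| < n.+1%:R^-1) /\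
    forall y : 'rV[R]_d, (forall i, `|y 0 i - ratr (q 0 i)| < n.+1%:R^-1) -> A y.
Proof.
rewrite openE => oA /oA /nbhs_ballP[e /= e0 eA].
(* Both [x] and [y] will be within this radius of the centre, whence half of [e]. *)
have [n n0] : exists n, n.+1%:R^-1 < e / 2.
  have /ltr_add_invr[n] : 0 < e / 2 by rewrite divr_gt0.
  by rewrite add0r => ?; exists n.
have n1 : 0 < n.+1%:R^-1 :> R by rewrite invr_gt0.
have /choice[q qP] : forall i, exists q : rat, `|x 0 i - ratr q| < n.+1%:R^-1.
  move=> i; have /rat_in_itvoo[q] : x 0 i - n.+1%:R^-1 < x 0 i + n.+1%:R^-1.
    by rewrite ltrBlDr -addrA ltrDl addr_gt0.
  move: (n.+1%:R^-1) => c; rewrite in_itv/= => /andP[q1 q2].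
  by exists q; rewrite ltr_norml; lra.
exists (\row_i q i), n; split=> [i|y yP]; first by rewrite mxE.
apply: eA; split=> // i j; rewrite (ord1 i) /ball/=.
move: (n.+1%:R^-1) (yP j) (qP j) n0 => c; rewrite mxE !ltr_norml; lra.
Qed.

(** Reduces both measures to coordinate half-spaces: rational cubes are finite intersections of
    these, and an open set is the countable union of the cubes that it contains. *)
Lemma caratheodory_open (R : realType) d (mu : {outer_measure set 'rV[R]_d -> \bar R}) :
  (forall i c, mu.-caratheodory [set x : 'rV[R]_d | x 0 i < c]) ->
  forall A, open A -> mu.-caratheodory A.
Proof.
move=> mhalf A oA.
pose mes := @measurable _ (caratheodory_type mu).
have mlt i c : mes [set x : 'rV[R]_d | x 0 i < c] by exact: mhalf.
have mle i c : mes [set x : 'rV[R]_d | c < x 0 i].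
  have -> : [set x : 'rV[R]_d | c < x 0 i] =
      \bigcup_n ~` [set x : 'rV[R]_d | x 0 i < c + n.+1%:R^-1].
    apply/seteqP; split=> [x /= cx|x [n _] /= /negP].
      have /ltr_add_invr [n nx] : c < x 0 i by [].
      by exists n => //=; apply/negP; rewrite -leNgt ltW.
    rewrite -leNgt; apply: lt_le_trans.
    by rewrite ltrDl invr_gt0 ltr0n.
  by apply: bigcup_measurable => n _; apply: measurableC; exact: mlt.
pose B (p : 'rV[rat]_d * nat) : set 'rV[R]_d :=
  \bigcap_(i in [set: 'I_d]) ([set x : 'rV[R]_d | x 0 i < ratr (p.1 0 i) + p.2.+1%:R^-1] `&`
     [set x : 'rV[R]_d | ratr (p.1 0 i) - p.2.+1%:R^-1 < x 0 i]).
have mB p : mes (B p).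
  apply: (@fin_bigcap_measurable _ (caratheodory_type mu)) => [|i _].
    exact: finite_finset.
  by apply: measurableI; [exact: mlt|exact: mle].
have -> : A = \bigcup_(p in [set p | B p `<=` A]) B p.
  apply/seteqP; split=> [x Ax|x [p BA] /BA//].
  have [q [n [xq BA]]] := open_rat_box oA Ax.
  exists (q, n); last first.
    move=> i _; move: (xq i); rewrite ltr_norml /=.
    by move: (_^-1) => c; split; lra.
  move=> y By; apply: BA => i; have [] := By i I; rewrite /= ltr_norml.
  by move: (_^-1) => c; lra.
rewrite bigcup_mkcond.
apply: (@countable_bigcupT_measurable _ (caratheodory_type mu)) => // p.
case: ifP => _; first exact: mB.
exact: (@measurable0 _ (caratheodory_type mu)).
Qed.

Lemma box_weight_le (R : realType) d (a b : 'rV[R]_d) :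
  (forall i, a 0 i <= b 0 i) ->
  (box_weight (box a b : set (all_sets R d)) <= (\prod_i (b 0 i - a 0 i))%:E)%E.
Proof.
move=> ab; rewrite /box_weight; case: ifPn => _.
  by rewrite lee_fin prodr_ge0// => i _; rewrite subr_ge0.
by apply: ereal_inf_lbound; exists (a, b).
Qed.

(** Half-open boxes are stable under this cut: both pieces are boxes of the same kind, and their
    volumes add up exactly. *)
Lemma box_weight_half (R : realType) d (A : set (all_sets R d)) i c :
  (box_weight (A `&` [set x : 'rV[R]_d | (x 0 i < c)%R])
   + box_weight (A `&` ~` [set x : 'rV[R]_d | (x 0 i < c)%R]) <= box_weight A)%E.
Proof.
have [->|A0] := eqVneq A set0.
  by rewrite !set0I box_weight0 adde0.
rewrite {3}/box_weight (negbTE A0).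
apply: le_ereal_inf_tmp => _ [[a b] /= [ab ->] <-].
(* [c] clamped to the [i]-th side, so that the corners stay ordered even when the hyperplane misses
   the box. *)
set m := Num.max (a 0 i) (Num.min (b 0 i) c).
have am : a 0 i <= m by rewrite le_max lexx.
have mb : m <= b 0 i by rewrite ge_max ab ge_min lexx.
pose b' := \row_j (if j == i then m else b 0 j).
pose a' := \row_j (if j == i then m else a 0 j).
have mP x : a 0 i <= x -> x < b 0 i -> (x < m) = (x < c).
  move=> ax xb; rewrite /m lt_max lt_min xb/=.
  by rewrite ltNge ax.
have -> : box a b `&` [set x | x 0 i < c] = box a b'.
  apply/seteqP; split=> [x [xab /= xc] j|x xab].
    rewrite mxE; case: eqP => [->|_]; last exact: xab.
    by have /andP[ax xb] := xab i; rewrite ax mP.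
  have xb : x 0 i < b 0 i.
    by have /andP[_] := xab i; rewrite mxE eqxx => /lt_le_trans; apply.
  have /andP[ax xm] := xab i; rewrite mxE eqxx in xm.
  split=> [j|/=]; last by rewrite -mP.
  by have := xab j; rewrite mxE; case: eqP => [-> _|//]; rewrite ax.
have -> : box a b `&` ~` [set x | x 0 i < c] = box a' b.
  apply/seteqP; split=> [x [xab /= xc] j|x xab].
    rewrite mxE; case: eqP => [->|_]; last exact: xab.
    by have /andP[ax xb] := xab i; rewrite xb leNgt mP// andbT; apply/negP.
  have ax : a 0 i <= x 0 i.
    by have /andP[+ _] := xab i; rewrite mxE eqxx; apply: le_trans.
  have /andP[mx xb] := xab i; rewrite mxE eqxx in mx.
  split=> [j|/=]; last by rewrite -mP// ltNge mx.
  by have := xab j; rewrite mxE; case: eqP => [-> _|//]; rewrite ax.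
apply: le_trans.
  apply: leeD; apply: box_weight_le => j; rewrite mxE; case: eqP => [->//|_];
    exact: ab.
rewrite -EFinD lee_fin (bigD1 i)//= [X in _ + X](bigD1 i)//= [leRHS](bigD1 i)//=.
rewrite !mxE eqxx.
under eq_bigr => j /negbTE ji do rewrite mxE ji.
under [X in _ + _ * X]eq_bigr => j /negbTE ji do rewrite mxE ji.
by rewrite -mulrDl [X in X * _](_ : _ = b 0 i - a 0 i)//; ring.
Qed.

Lemma leb_open (R : realType) d (A : set 'rV[R]_d) :
  open A -> (leb_outer R d).-caratheodory A.
Proof.
apply: caratheodory_open => i c; apply: le_caratheodory_measurable => X.
apply: (@mu_ext_split _ (all_sets R d)).
- exact: all_sets_measurable.
- exact: all_sets_measurable.
- exact: box_weight_ge0.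
- by move=> A'; exact: box_weight_half.
Qed.

(** For Hausdorff measure the two suprema range over independent mesh sizes. Nonnegativity and a
    finite [M] make every term finite, so terms can be moved across the inequality. *)
Lemma ereal_sup_add_le (R : realType) (S1 S2 : set \bar R) (M : \bar R) :
  S1 !=set0 -> S2 !=set0 ->
  (forall x, S1 x -> 0 <= x)%E -> (forall x, S2 x -> 0 <= x)%E ->
  (forall x y, S1 x -> S2 y -> x + y <= M)%E ->
  (ereal_sup S1 + ereal_sup S2 <= M)%E.
Proof.
move=> [x0 Sx0] [y0 Sy0] S1ge0 S2ge0 SM.
have [->|Mfin] := eqVneq M +oo%E; first exact: leey.
have M0 : (0 <= M)%E.
  exact: le_trans (adde_ge0 (S1ge0 _ Sx0) (S2ge0 _ Sy0)) (SM _ _ Sx0 Sy0).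
have fM : M \is a fin_num by rewrite ge0_fin_numE// ltey.
have S2fin y : S2 y -> y \is a fin_num.
  move=> Sy; rewrite ge0_fin_numE ?S2ge0//.
  apply: (@le_lt_trans _ _ M); last by rewrite ltey.
  apply: le_trans (SM _ _ Sx0 Sy); rewrite leeDr//; exact: S1ge0.
have S1M y : S2 y -> (ereal_sup S1 <= M - y)%E.
  move=> Sy; apply: ge_ereal_sup => x Sx.
  by rewrite leeBrDr ?S2fin//; exact: SM.
have S1fin : ereal_sup S1 \is a fin_num.
  rewrite ge0_fin_numE; last first.
    by apply: le_trans (S1ge0 _ Sx0) _; exact: ereal_sup_ubound.
  apply: le_lt_trans (S1M _ Sy0) _.
  by rewrite ltey_eq fin_numB fM S2fin.
rewrite addeC -leeBrDr//; apply: ge_ereal_sup => y Sy.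
by rewrite leeBrDr// addeC -leeBrDr ?S2fin// S1M.
Qed.

(* Caratheodory's criterion, with the function [h] in place of the distance to
   a closed set. The slices [D k] add up to at most [2 H X] because [D n.+1] is
   separated from [B n], although not from [B n.+1]. *)
Lemma separated_caratheodory (R : realType) (T : Type)
    (H : {outer_measure set T -> \bar R}) (h : T -> R) (c : R) :
  (forall a b X, a < b -> (H (X `&` [set x | (h x <= a)%R]) +
                           H (X `&` [set x | (b <= h x)%R]) <= H X)%E) ->
  H.-caratheodory [set x | h x < c].
Proof.
move=> sep; apply: le_caratheodory_measurable => X.
have [->|HXoo] := eqVneq (H X) +oo%E; first exact: leey.
have HX : H X \is a fin_num by rewrite ge0_fin_numE ?outer_measure_ge0// ltey.
pose s n : R := c - n.+1%:R^-1.
have sS n : s n < s n.+1.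
  by rewrite ltrD2l ltrN2 ltf_pV2 ?posrE ?ltr0n// ltr_nat.
have sc n : s n < c by rewrite ltrBlDr ltrDl invr_gt0 ltr0n.
pose B n := X `&` [set x | h x <= s n].
pose D n := X `&` [set x | s n < h x <= s n.+1].
have D0 n : (0 <= H (D n))%E by exact: outer_measure_ge0.
have BX n : (H (B n) <= H X)%E by apply: le_outer_measure => x [].
have sumD n : (\sum_(0 <= k < n.+1) H (D k) <= H (B n.+1) + H (B n))%E.
  elim: n => [|n IH].
    rewrite big_nat1; apply: le_trans (leeDl _ (outer_measure_ge0 _ _)).
    by apply: le_outer_measure => x [Xx /andP[_ xs]].
  rewrite big_nat_recr//=; apply: le_trans (leeD IH (lexx _)) _.
  rewrite -addeA addeC leeD//.
  apply: le_trans (sep (s n) (s n.+1) (B n.+2) (sS n)); rewrite addeC.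
  rewrite addeC; apply: leeD; apply: le_outer_measure.
    move=> x [Xx /= hs]; split=> //; split=> //=.
    exact: le_trans hs (ltW (lt_trans (sS n) (sS n.+1))).
  by move=> x [Xx /= /andP[/ltW sh hs]]; split.
have sumDX : (\sum_(k <oo) H (D k) <= H X + H X)%E.
  apply: lime_le; first exact: is_cvg_nneseries.
  apply: nearW => -[|n]; first by rewrite big_geq//; apply: adde_ge0; exact: outer_measure_ge0.
  exact: le_trans (sumD n) (leeD (BX _) (BX _)).
(* Beyond a suitable [N] the slices weigh at most [e] in total. Up to that error [B N] exhausts the
   part where [h < c], and it is separated from the part where [c <= h]. *)
apply/lee_addgt0Pr => e e0.
have tail : (\sum_(N <= k <oo) H (D k))%E @[N --> \oo] --> 0%E.
  apply: nneseries_tail_cvg => //; apply: le_lt_trans sumDX _.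
  by rewrite ltey_eq fin_numD HX.
have [N tailN] : exists N, (\sum_(N <= k <oo) H (D k) <= e%:E)%E.
  have : \forall N \near \oo, (\sum_(N <= k <oo) H (D k) < e%:E)%E.
    by apply: (tail [set y | (y < e%:E)%E]); apply: open_ereal_lt'; rewrite lte_fin.
  by case=> N _ /(_ N (leqnn _)) /ltW; exists N.
have cover : (H (X `&` [set x | (h x < c)%R]) <=
    H (B N) + \sum_(N <= k <oo) H (D k))%E.
  rewrite -nneseries_addn//.
  apply: (@le_trans _ _ (H (B N `|` \bigcup_k D (k + N)%N))).
    apply: le_outer_measure => x [Xx /= hc].
    have [hN|Nh] := leP (h x) (s N); first by left.
    right; have [n] : exists n, h x <= s (n + N).+1.
      have /ltr_add_invr[n nc] : h x < c by [].
      exists n; rewrite /s lerBrDr (le_trans _ (ltW nc))// lerD2l.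
      by rewrite lef_pV2 ?posrE ?ltr0n// ler_nat !ltnS (leq_trans (leq_addr N n)).
    elim: n => [hN|n IH hn]; first by exists 0%N => //; split=> //=; rewrite Nh.
    have [/IH//|nh] := leP (h x) (s (n + N).+1).
    by exists n.+1 => //; split=> //=; rewrite nh.
  apply: le_trans (outer_measureU2 _ _ _) _; rewrite leeD2l//.
  exact: outer_measure_sigma_subadditive.
apply: le_trans (leeD cover (lexx _)) _.
rewrite addeAC; apply: leeD => //.
apply: le_trans (sep (s N) c X (sc N)); apply: leeD => //.
by apply: le_outer_measure => x [Xx /= /negP]; rewrite -leNgt.
Qed.

Lemma mu_ext_mono disp (T : measurableType disp) (R : realType)
    (w1 w2 : set T -> \bar R) X :
  (forall A, 0 <= w1 A)%E -> (forall A, w1 A <= w2 A)%E ->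
  (mu_ext w1 X <= mu_ext w2 X)%E.
Proof.
move=> w0 w12; apply: le_ereal_inf_tmp => _ [F [mF XF] <-].
apply: (@le_trans _ _ (\sum_(k <oo) w1 (F k))%E).
  by apply: ereal_inf_lbound; exists F.
by apply: lee_nneseries.
Qed.

Lemma diam_ge0 (R : realType) d (A : set 'rV[R]_d) : (0 <= diam A)%E.
Proof. by apply: ereal_sup_ubound; left. Qed.

Lemma le_diam (R : realType) d (A B : set 'rV[R]_d) :
  A `<=` B -> (diam A <= diam B)%E.
Proof.
move=> AB; apply: ge_ereal_sup => x Ax; apply: ereal_sup_ubound.
case: Ax => [->|[p [Ap1 Ap2] <-]]; [by left|right; exists p => //].
by split; exact: AB.
Qed.

Lemma diam_weight_mono (R : realType) d k (delta delta' : R)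
    (A B : set (all_sets R d)) :
  delta' <= delta -> A `<=` B ->
  (diam_weight k delta A <= diam_weight k delta' B)%E.
Proof.
move=> dd AB; rewrite {1}/diam_weight; have [_|A0] := eqVneq A set0.
  exact: diam_weight_ge0.
rewrite /diam_weight; have B0 : B != set0.
  by apply: contra_neq A0 => B0; apply/seteqP; split=> // x /AB; rewrite B0.
rewrite (negbTE B0); case: (leP (diam B)) => [Bd|_]; last exact: leey.
rewrite (le_trans (le_diam AB) (le_trans Bd _)) ?lee_fin//.
have e0 (C : set 'rV[R]_d) j : (0 <= ((2^-1)%R%:E * diam C) ^+ j)%E.
  by apply: expe_ge0; apply: mule_ge0; [rewrite lee_fin invr_ge0|exact: diam_ge0].
apply: lee_pmul => //; first exact: outer_measure_ge0.
elim: k => [//|k IH]; rewrite !expeS; apply: lee_pmul => //.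
- by apply: mule_ge0; [rewrite lee_fin invr_ge0|exact: diam_ge0].
- by apply: lee_pmul; rewrite ?diam_ge0 ?le_diam// lee_fin invr_ge0.
Qed.

(** Once the mesh is below [e], a covering set of finite weight meets at most one of [P] and [Q], so
    cutting a cover does not increase its total weight. *)
Lemma hausdorff_separated (R : realType) d k (e : R) (P Q X : set 'rV[R]_d) :
  0 < e -> (forall x y, P x -> Q y -> e <= enorm (x - y)) ->
  (hausdorff k (X `&` P) + hausdorff k (X `&` Q) <= hausdorff k X)%E.
Proof.
move=> e0 ePQ; apply: ereal_sup_add_le.
- by eexists; exists 1 => //=; exact: ltr01.
- by eexists; exists 1 => //=; exact: ltr01.
- move=> _ [delta _ <-]; apply: mu_ext_ge0; exact: diam_weight_ge0.
- move=> _ [delta _ <-]; apply: mu_ext_ge0; exact: diam_weight_ge0.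
move=> _ _ [d1 d10 <-] [d2 d20 <-].
(* At most [e / 2], hence strictly below the separation, and at most both given meshes; refining the
   mesh only increases the outer measure. *)
pose delta := Num.min (e / 2) (Num.min d1 d2).
have delta0 : 0 < delta by rewrite !lt_min divr_gt0//= d10.
apply: (@le_trans _ _ (mu_ext (@diam_weight R d k delta) X)); last first.
  by apply: ereal_sup_ubound; exists delta.
have mono d' Y : delta <= d' -> (mu_ext (@diam_weight R d k d') Y <=
    mu_ext (@diam_weight R d k delta) Y)%E.
  move=> dd; apply: mu_ext_mono => A; first exact: diam_weight_ge0.
  exact: diam_weight_mono.
apply: le_trans (leeD (mono d1 _ _) (mono d2 _ _)) _.
- by rewrite /delta !ge_min lexx orbT.
- by rewrite /delta !ge_min lexx !orbT.
apply: (@mu_ext_split _ (all_sets R d)).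
- exact: all_sets_measurable.
- exact: all_sets_measurable.
- exact: diam_weight_ge0.
move=> A; have [AP|/set0P[x [Ax Px]]] := eqVneq (A `&` P) set0.
  by rewrite AP diam_weight0 add0e; apply: diam_weight_mono => // x [].
have [AQ|/set0P[y [Ay Qy]]] := eqVneq (A `&` Q) set0.
  by rewrite AQ diam_weight0 adde0; apply: diam_weight_mono => // z [].
rewrite [leRHS]/diam_weight ifN; last by apply/set0P; exists x.
rewrite ifN ?leey// -ltNge (@lt_le_trans _ _ (enorm (x - y))%:E)//.
  rewrite lte_fin (lt_le_trans _ (ePQ _ _ Px Qy))//.
  by rewrite /delta gt_min; apply/orP; left; lra.
by apply: ereal_sup_ubound; right; exists (x, y).
Qed.

Lemma coord_le_enorm (R : realType) m n (A : 'M[R]_(m, n)) i j :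
  `|A i j| <= enorm A.
Proof.
rewrite -sqrtr_sqr ler_wsqrtr// expr2 /mdot.
rewrite (bigD1 i)//= (bigD1 j)//= -addrA lerDl addr_ge0//.
  by apply: sumr_ge0 => k _; rewrite -expr2 sqr_ge0.
by apply: sumr_ge0 => k _; apply: sumr_ge0 => l _; rewrite -expr2 sqr_ge0.
Qed.

(** A coordinate is 1-Lipschitz for the Euclidean norm, so the sets [x 0 i <= a] and [b <= x 0 i]
    are at distance at least [b - a]. *)
Lemma surface_open (R : realType) d (A : set 'rV[R]_d) :
  open A -> (surface_outer R d).-caratheodory A.
Proof.
apply: caratheodory_open => i c; apply: separated_caratheodory => a b X ab.
apply: (@hausdorff_separated _ _ _ (b - a)) => [|x y /= xa yb].
  by rewrite subr_gt0.
apply: le_trans (coord_le_enorm _ 0 i); rewrite !mxE distrC.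
by apply: le_trans (ler_norm _); apply: lerB.
Qed.

(* Integrating the inequality between indicator functions over one coordinate
   at a time avoids the compactness argument for covers by boxes. *)
Lemma box_cover_prod (R : realType) (I : eqType) (s : seq I) (a b : I -> R)
    (A B : nat -> I -> R) (c : R) (w : nat -> R) :
  uniq s -> (forall i, a i <= b i) -> (forall k i, A k i <= B k i) ->
  0 <= c -> (forall k, 0 <= w k) ->
  (forall x : I -> R, (forall i, i \in s -> a i <= x i < b i) ->
     (c%:E <= \sum_(k <oo) (w k * (all (fun i => A k i <= x i < B k i) s)%:R)%:E)%E) ->
  ((c * \prod_(i <- s) (b i - a i))%:E <=
    \sum_(k <oo) (w k * \prod_(i <- s) (B k i - A k i))%:E)%E.
Proof.
elim: s c w => [|j s IH] c w.
  move=> _ _ _ _ _ /(_ a) /=; rewrite big_nil mulr1.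
  by under [in X in _ -> X]eq_eseriesr do rewrite big_nil; apply.
move=> /= /andP[js us] ab AB c0 w0 cov.
pose D := `[a j, b j[%classic : set (measurableTypeR R).
pose J k := `[A k j, B k j[%classic : set (measurableTypeR R).
pose mu := @lebesgue_measure R.
have mD : measurable D by exact: measurable_itv.
have mJ k : measurable (J k) by exact: measurable_itv.
pose v k := w k * \prod_(i <- s) (B k i - A k i).
have v0 k : 0 <= v k.
  by rewrite mulr_ge0// prodr_ge0// => i _; rewrite subr_ge0.
(* With coordinate [j] frozen at [y], the indicator of the [j]-th side is absorbed into the weights
   [w], which is why the induction is over arbitrary weights. *)
have slice (y : R) : D y -> ((c * \prod_(i <- s) (b i - a i))%:E <=
    \sum_(k <oo) ((v k)%:E * (\1_(J k) y)%:E))%E.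
  rewrite /D/= in_itv/= => Dy.
  have IHy := IH c (fun k => w k * (A k j <= y < B k j)%R%:R) us ab AB c0.
  apply: le_trans (IHy _ _) _.
  - by move=> k; rewrite mulr_ge0.
  - move=> x xP; have := cov (fun i => if i == j then y else x i).
    have sj i : i \in s -> (i == j) = false.
      by move=> si; apply/negbTE; apply: contraNneq js => <-.
    have h i : i \in j :: s -> a i <= (if i == j then y else x i) < b i.
      by rewrite inE; case: eqP => [->//|_ /= si]; exact: xP.
    move=> /(_ h); congr (_ <= _)%E; apply: eq_eseriesr => k _.
    rewrite eqxx -mulrA -natrM mulnb; congr (_ * (_ && _)%:R)%:E.
    by apply: eq_in_all => i /sj ->.
  - apply: lee_nneseries => k *; first rewrite lee_fin.
      by rewrite mulr_ge0// ?mulr_ge0// prodr_ge0// => i _; rewrite subr_ge0.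
    rewrite -EFinM lee_fin /v indicE.
    have -> : (y \in J k) = (A k j <= y < B k j) by rewrite /J mem_setE in_itv.
    by rewrite mulrAC.
have mu_itv (u z : R) : u <= z -> mu `[u, z[%classic = (z - u)%:E.
  rewrite /mu lebesgue_measure_itv/= lte_fin; case: ltP => // zu uz.
  by rewrite (@le_anti _ _ u z) ?uz ?subrr.
pose f k : measurableTypeR R -> \bar R := fun y => ((v k)%:E * (\1_(J k) y)%:E)%E.
have mv k : measurable_fun D (f k).
  apply: emeasurable_funM => //; apply/measurable_EFinP.
  exact: measurable_indic.
have v1 k y : (0 <= (v k)%:E * (\1_(J k) y)%:E)%E.
  by rewrite mule_ge0// lee_fin.
rewrite big_cons mulrCA mulrC EFinM -(mu_itv _ _ (ab j)) -integral_cst//.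
apply: (@le_trans _ _ (\int[mu]_(y in D) \sum_(k <oo) ((v k)%:E * (\1_(J k) y)%:E))%E).
  apply: ge0_le_integral => //.
  - by move=> y _; rewrite lee_fin mulr_ge0// prodr_ge0// => i _; rewrite subr_ge0.
  - by apply: (@ge0_emeasurable_sum _ _ _ D f xpredT) => // k y _ _; exact: v1.
rewrite integral_nneseries//; apply: lee_nneseries => k *.
  exact: integral_ge0.
rewrite ge0_integralZl_EFin//; last first.
  by apply/measurable_EFinP; exact: measurable_indic.
rewrite integral_indic// big_cons mulrCA mulrC -/(v k) [leRHS]EFinM.
(* Integrating the indicator yields the length of the part of [J k] inside [D], at most the full
   side. *)
apply: lee_pmul; rewrite ?lee_fin// -(mu_itv _ _ (AB k j)).
by apply: le_measure; rewrite ?inE//; exact: measurableI.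
Qed.

(** A point of the smaller box is moved along its whole [i]-th side. Nonemptiness is essential: the
    corners of an empty box are not determined. *)
Lemma box_sub_le (R : realType) d (a b a' b' : 'rV[R]_d) :
  (box a b !=set0) -> box a b `<=` box a' b' ->
  forall i, a' 0 i <= a 0 i /\ b 0 i <= b' 0 i.
Proof.
move=> [x xab] sub i.
have axb : a 0 i < b 0 i by have /andP[] := xab i; exact: le_lt_trans.
have upd y : a 0 i <= y < b 0 i -> a' 0 i <= y < b' 0 i.
  move=> yab; have := sub (\row_j if j == i then y else x 0 j).
  have h j : a 0 j <= (\row_j if j == i then y else x 0 j) 0 j < b 0 j.
    by rewrite mxE; case: eqP => [->//|_]; exact: xab.
  by move=> /(_ h i); rewrite mxE eqxx.
split; first by have /upd/andP[] : a 0 i <= a 0 i < b 0 i by rewrite lexx.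
rewrite leNgt; apply/negP => bb.
have /upd/andP[_] : a 0 i <= Num.max (a 0 i) (b' 0 i) < b 0 i.
  by rewrite le_max lexx gt_max axb.
by rewrite gt_max ltxx andbF.
Qed.

(** The weight is an infimum over all pairs of corners, attained because a nonempty box determines
    its corners. In positive dimension the empty set lies in a degenerate box of volume 0. *)
Lemma box_weight_fin (R : realType) d (A : set (all_sets R d.+1)) :
  (box_weight A < +oo)%E -> exists a b : 'rV[R]_d.+1,
   [/\ forall i, a 0 i <= b 0 i, A `<=` box a b &
       ((\prod_i (b 0 i - a 0 i))%:E <= box_weight A)%E].
Proof.
have [->|A0] := eqVneq A set0.
  move=> _; exists 0, 0; split=> //.
  by rewrite (bigD1 ord0)//= subrr mul0r box_weight0.
rewrite /box_weight (negbTE A0) => /ereal_inf_lt[_ [[a b] /= [ab AE] _] _].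
exists a, b; split=> //; first by rewrite AE.
apply: le_ereal_inf_tmp => _ [[a' b'] /= [ab' AE'] <-].
have bab : box a b !=set0 by apply/set0P; rewrite -AE.
have sub : box a b `<=` box a' b' by rewrite -AE -AE'.
rewrite lee_fin; apply: ler_prod => i _; rewrite subr_ge0 ab/=.
by have [? ?] := box_sub_le bab sub i; exact: lerB.
Qed.

(** A cover with a set of infinite weight is trivial. Otherwise each set is enlarged to a box of no
    larger weight, and the product estimate is applied with constant and weights 1. *)
Lemma leb_box_ge (R : realType) d (a b : 'rV[R]_d.+1) :
  (forall i, a 0 i <= b 0 i) ->
  ((\prod_i (b 0 i - a 0 i))%:E <= leb (box a b))%E.
Proof.
move=> ab; apply: le_ereal_inf_tmp => _ [F [mF abF] <-].
have [[k Foo]|nFoo] := pselect (exists k, box_weight (F k) = +oo%E).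
  rewrite (eseries_pinfty _ _ Foo) ?leey// => n _.
  by rewrite gt_eqF// (lt_le_trans _ (box_weight_ge0 _)).
have {nFoo}Ffin k : (box_weight (F k) < +oo)%E.
  by rewrite ltey; apply/eqP => ?; apply: nFoo; exists k.
have /choice[p pP] : forall k, exists p : 'rV[R]_d.+1 * 'rV[R]_d.+1,
    [/\ forall i, p.1 0 i <= p.2 0 i, F k `<=` box p.1 p.2 &
      ((\prod_i (p.2 0 i - p.1 0 i))%:E <= box_weight (F k))%E].
  by move=> k; have [u [v uv]] := box_weight_fin (Ffin k); exists (u, v).
apply: (@le_trans _ _ (\sum_(k <oo) (\prod_i ((p k).2 0 i - (p k).1 0 i))%:E)%E);
    last first.
  apply: lee_nneseries => [k _ _|k _]; last by have [] := pP k.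
  by rewrite lee_fin prodr_ge0// => i _; rewrite subr_ge0; have [] := pP k.
rewrite -[X in (X%:E <= _)%E]mul1r.
under eq_eseriesr do rewrite -[X in X%:E]mul1r.
apply: (@box_cover_prod R _ (index_enum 'I_d.+1) (a 0) (b 0)
  (fun k => (p k).1 0) (fun k => (p k).2 0) 1 (fun=> 1)) => //.
- exact: index_enum_uniq.
- by move=> k i; have [] := pP k.
move=> x xab; have [k _ Fkx] : (\bigcup_k F k) (\row_i x i).
  by apply: abF => i; rewrite mxE; apply: xab; rewrite mem_index_enum.
rewrite (@nneseriesD1 _ _ k)//.
rewrite (_ : all _ _ = true) ?mul1r ?leeDl//.
  by apply: nneseries_ge0 => n _ _; rewrite lee_fin mul1r ler0n.
apply/allP => i _; have [_ /(_ _ Fkx) /(_ i)] := pP k.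
by rewrite mxE.
Qed.

Lemma coord_le_norm (R : realType) m n (A : 'M[R]_(m, n)) i j :
  `|A i j| <= `|A|.
Proof.
rewrite [leRHS]/Num.norm /= mx_normrE; apply/bigmax_geP; right.
by exists (i, j).
Qed.

Lemma leb_bounded (R : realType) d (A : set 'rV[R]_d) :
  bounded_set A -> (leb A < +oo)%E.
Proof.
move=> [M [Mr AM]].
(* The norm is bounded by any number above [M], here [|M| + 1]; one more unit makes the upper
   inequality strict, as a half-open box requires. *)
pose a : 'rV[R]_d := const_mx (- (`|M| + 2)).
pose b : 'rV[R]_d := const_mx (`|M| + 2).
have ab i : a 0 i <= b 0 i by rewrite !mxE; have := normr_ge0 M; lra.
apply: (@le_lt_trans _ _ (box_weight (box a b : set (all_sets R d)))); last first.
  by apply: le_lt_trans (box_weight_le ab) _; exact: ltry.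
apply: le_trans (mu_ext_le _ (box_weight0 _ _) (@box_weight_ge0 R d)).
apply: le_outer_measure => x Ax i; rewrite !mxE.
have /AM/(_ x Ax)/= : M < `|M| + 1 by rewrite ltr_pwDr// ler_norm.
by move=> /(le_trans (coord_le_norm x 0 i)); rewrite ler_norml; lra.
Qed.

Lemma leb_open_gt0 (R : realType) d (A : set 'rV[R]_d.+1) :
  open A -> A !=set0 -> (0 < leb A)%E.
Proof.
rewrite openE => oA [x /oA /nbhs_ballP[e /= e0 eA]].
pose a : 'rV[R]_d.+1 := \row_i (x 0 i - e / 2).
pose b : 'rV[R]_d.+1 := \row_i (x 0 i + e / 2).
have ab i : a 0 i < b 0 i by rewrite !mxE; lra.
apply: (@lt_le_trans _ _ (leb (box a b))).
  apply: lt_le_trans (leb_box_ge (fun i => ltW (ab i))).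
  by rewrite lte_fin prodr_gt0// => i _; rewrite subr_gt0.
apply: le_outer_measure => y yab; apply: eA; split=> // i j.
by rewrite (ord1 i) /ball/=; have := yab j; rewrite !mxE ltr_norml; lra.
Qed.

Lemma surface_closed (R : realType) d (A : set 'rV[R]_d) :
  closed A -> (surface_outer R d).-caratheodory A.
Proof.
move=> cA; rewrite -(setCK A); apply: caratheodory_measurable_setC.
by apply: surface_open; exact: closed_openC.
Qed.

Lemma continuous_leb_measurable (R : realType) d (h : 'rV[R]_d -> R)
    (D : set (caratheodory_type (leb_outer R d))) :
  continuous h -> measurable_fun D h.
Proof.
move=> ch; apply: (@measurable_funS _ _ _ _ setT) => // mT.
apply: (measurability _ (RGenOInfty.measurableE R)) => //.
move=> _ [_ [a ->] <-]; rewrite setTI.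
apply: leb_open; apply: open_comp => [x _|]; first exact: ch.
by rewrite set_itvoy; exact: open_gt.
Qed.

(** * Semi-inner products and square-integrable fields *)

(** Linearity is asked only on [S], since integrals split only for integrable functions, and
    definiteness is absent, since functions are not quotiented by a.e. equality. Instances are
    [mdot], [L2dot], [Cdot] and [H1dot]. *)
Definition semi_inner (R : realType) (V : lmodType R) (S : V -> Prop)
    (b : V -> V -> R) : Prop :=
  [/\ forall a u v, S u -> S v -> S (a *: u + v),
      forall a u v w, S u -> S v -> S w -> b (a *: u + v) w = a * b u w + b v w,
      forall u v, S u -> S v -> b u v = b v u
    & forall u, S u -> 0 <= b u u].

Section semi_inner_theory.
Variables (R : realType) (V : lmodType R) (S : V -> Prop) (b : V -> V -> R).
Hypothesis Sb : semi_inner S b.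
Let N u := Num.sqrt (b u u).

Lemma semi_innerP a u v : S u -> S v -> S (a *: u + v).
Proof. by have [+ _ _ _] := Sb; apply. Qed.

Lemma semi_inner0 u : S u -> S 0.
Proof. by move=> Su; rewrite -(addNr u) -scaleN1r; exact: semi_innerP. Qed.

Lemma semi_innerZ a u : S u -> S (a *: u).
Proof.
move=> Su; rewrite -[_ *: _]addr0; apply: semi_innerP => //.
exact: semi_inner0 Su.
Qed.

Lemma semi_innerD u v : S u -> S v -> S (u + v).
Proof. by move=> Su Sv; rewrite -(scale1r u); exact: semi_innerP. Qed.

Lemma semi_innerB u v : S u -> S v -> S (u - v).
Proof. by move=> Su Sv; rewrite addrC -scaleN1r; exact: semi_innerP. Qed.

Lemma semi_inner_lin a u v w : S u -> S v -> S w ->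
  b (a *: u + v) w = a * b u w + b v w.
Proof. by have [_ + _ _] := Sb; apply. Qed.

Lemma semi_innerC u v : S u -> S v -> b u v = b v u.
Proof. by have [_ _ + _] := Sb; apply. Qed.

Lemma semi_inner_ge0 u : S u -> 0 <= b u u.
Proof. by have [_ _ _ +] := Sb; apply. Qed.

Lemma semi_inner_addl u v w : S u -> S v -> S w -> b (u + v) w = b u w + b v w.
Proof. by move=> *; rewrite -(scale1r u) semi_inner_lin ?mul1r ?scale1r. Qed.

Lemma semi_inner_subl u v w : S u -> S v -> S w -> b (u - v) w = b u w - b v w.
Proof. by move=> *; rewrite addrC -scaleN1r semi_inner_lin// mulN1r addrC. Qed.

Lemma semi_inner_scalel a u w : S u -> S w -> b (a *: u) w = a * b u w.
Proof.
move=> Su Sw; have S0 := semi_inner0 Su.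
have b0 : b 0 w = 0 by rewrite -(subrr u) semi_inner_subl// subrr.
by rewrite -[a *: u]addr0 semi_inner_lin// b0 addr0.
Qed.

Lemma semi_inner_addr u v w : S u -> S v -> S w -> b w (u + v) = b w u + b w v.
Proof.
move=> *; rewrite semi_innerC// ?semi_inner_addl ?[b u w]semi_innerC ?[b v w]semi_innerC//.
exact: semi_innerD.
Qed.

Lemma semi_inner_subr u v w : S u -> S v -> S w -> b w (u - v) = b w u - b w v.
Proof.
move=> *; rewrite semi_innerC// ?semi_inner_subl ?[b u w]semi_innerC ?[b v w]semi_innerC//.
exact: semi_innerB.
Qed.

Lemma semi_inner_scaler a u w : S u -> S w -> b w (a *: u) = a * b w u.
Proof.
move=> *; rewrite semi_innerC ?semi_inner_scalel ?[b u w]semi_innerC//.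
exact: semi_innerZ.
Qed.

Lemma semi_inner_sqrD u v : S u -> S v ->
  b (u + v) (u + v) = b u u + 2 * b u v + b v v.
Proof.
move=> Su Sv; rewrite semi_inner_addl ?semi_inner_addr//; last exact: semi_innerD.
rewrite (semi_innerC Sv Su); ring.
Qed.

Lemma seminorm_sqr u : S u -> N u ^+ 2 = b u u.
Proof. by move=> Su; rewrite sqr_sqrtr// semi_inner_ge0. Qed.

Lemma seminormZ a u : S u -> N (a *: u) = `|a| * N u.
Proof.
move=> Su; rewrite /N semi_inner_scalel ?semi_inner_scaler//; last exact: semi_innerZ.
by rewrite mulrA -expr2 sqrtrM ?sqr_ge0// sqrtr_sqr.
Qed.

Lemma seminorm0 : S 0 -> N 0 = 0.
Proof. by move=> S0; rewrite -(scale0r 0) seminormZ// normr0 mul0r. Qed.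

Lemma Cauchy_Schwarz u v : S u -> S v -> `|b u v| <= N u * N v.
Proof.
move=> Su Sv; rewrite -sqrtrM ?semi_inner_ge0// -sqrtr_sqr ler_wsqrtr//.
have quad (s t : R) : 0 <= s ^+ 2 * b u u + 2 * s * t * b u v + t ^+ 2 * b v v.
  have Ssu := semi_innerZ s Su; have Stv := semi_innerZ t Sv.
  have := semi_inner_ge0 (semi_innerD Ssu Stv).
  rewrite semi_inner_addl ?semi_inner_addr//; last exact: semi_innerD.
  rewrite !semi_inner_scalel ?semi_inner_scaler// (semi_innerC Sv Su).
  by congr (_ <= _); ring.
have uu := semi_inner_ge0 Su; have vv := semi_inner_ge0 Sv.
have [vv0|vv0] := eqVneq (b v v) 0; last first.
  have {vv}vv : 0 < b v v by rewrite lt_def vv0.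
  (* The minimising ratio cleared of denominators: [b v v] times the Gram determinant remains. *)
  have := quad (b v v) (- b u v).
  rewrite [X in _ <= X](_ : _ = b v v * (b u u * b v v - b u v ^+ 2)); last by ring.
  by rewrite pmulr_rge0// subr_ge0.
(* In the degenerate case [b v v = 0] this choice makes the quadratic equal to [- b u v ^+ 2], which
   forces [b u v = 0]. *)
have := quad (b u v) (- (b u u + 1) / 2).
rewrite vv0 !mulr0 addr0.
rewrite [X in _ <= X](_ : _ = - b u v ^+ 2); last by field.
by rewrite oppr_ge0.
Qed.

Lemma seminormD u v : S u -> S v -> N (u + v) <= N u + N v.
Proof.
move=> Su Sv; have Suv := semi_innerD Su Sv.
rewrite -(@ler_pXn2r _ 2)// ?nnegrE ?addr_ge0 ?sqrtr_ge0//.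
rewrite sqrrD !seminorm_sqr// semi_inner_sqrD// -mulr_natl.
have := le_trans (ler_norm _) (Cauchy_Schwarz Su Sv).
by rewrite -/(N u) -/(N v); lra.
Qed.

Lemma seminormBC u v : S u -> S v -> N (u - v) = N (v - u).
Proof.
move=> Su Sv; rewrite -(opprB v u) -[- (v - u)]scaleN1r (seminormZ _ (semi_innerB Sv Su)).
by rewrite normrN1 mul1r.
Qed.

Lemma seminormB u v : S u -> S v -> `|N u - N v| <= N (u - v).
Proof.
move=> Su Sv; have := seminormD (semi_innerB Sv Su) Su.
have := seminormD (semi_innerB Su Sv) Sv; rewrite !subrK (seminormBC Sv Su).
by rewrite ler_norml; lra.
Qed.

End semi_inner_theory.

Lemma mdotDZl (R : realType) m n (a : R) (A B C : 'M[R]_(m, n)) :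
  mdot (a *: A + B) C = a * mdot A C + mdot B C.
Proof.
rewrite /mdot mulr_sumr -big_split/=; apply: eq_bigr => i _.
rewrite mulr_sumr -big_split/=; apply: eq_bigr => j _.
by rewrite !mxE; ring.
Qed.

Lemma mdotC (R : realType) m n (A B : 'M[R]_(m, n)) : mdot A B = mdot B A.
Proof. by apply: eq_bigr => i _; apply: eq_bigr => j _; rewrite mulrC. Qed.

Lemma mdot_ge0 (R : realType) m n (A : 'M[R]_(m, n)) : 0 <= mdot A A.
Proof.
by apply: sumr_ge0 => i _; apply: sumr_ge0 => j _; rewrite -expr2 sqr_ge0.
Qed.

Lemma mdot_eq0 (R : realType) m n (A : 'M[R]_(m, n)) : mdot A A = 0 -> A = 0.
Proof.
move=> A0; apply/matrixP => i j; rewrite mxE; apply/eqP; rewrite -normr_le0.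
by apply: le_trans (coord_le_enorm A i j) _; rewrite /enorm A0 sqrtr0.
Qed.

Lemma mdot_semi_inner (R : realType) m n :
  semi_inner (fun _ : 'M[R]_(m, n) => True) (@mdot R m n).
Proof.
by split=> *; [|exact: mdotDZl|exact: mdotC|exact: mdot_ge0].
Qed.

Section L2_theory.
Context (R : realType) (disp : measure_display) (T : measurableType disp).
Variables (mu : {measure set T -> \bar R}) (D : set T).
Hypothesis mD : measurable D.

Definition sq_integrable (h : T -> R) : Prop :=
  measurable_fun D h /\ mu.-integrable D (fun x => (h x ^+ 2)%:E).

Lemma sq_integrableM h k : sq_integrable h -> sq_integrable k ->
  mu.-integrable D (fun x => (h x * k x)%:E).
Proof.
move=> [mh ih] [mk ik].
apply: (@le_integrable _ _ _ _ _ mD _ (fun x => (h x ^+ 2)%:E + (k x ^+ 2)%:E)%E) => //.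
- by apply/measurable_EFinP; exact: measurable_funM.
- move=> x _; rewrite -EFinD !abse_EFin lee_fin.
  rewrite [leRHS]ger0_norm ?addr_ge0 ?sqr_ge0// normrM.
  rewrite -(real_normK (num_real (h x))) -(real_normK (num_real (k x))).
  have := sqr_ge0 (`|h x| - `|k x|); rewrite sqrrB mulr2n.
  have : 0 <= `|h x| * `|k x| by rewrite mulr_ge0.
  move: (_ * _) (_ ^+ 2) (_ ^+ 2) => p q r; lra.
- exact: integrableD.
Qed.

Lemma sq_integrable_lin a h k : sq_integrable h -> sq_integrable k ->
  sq_integrable (fun x => a * h x + k x).
Proof.
move=> sh sk; have [mh ih] := sh; have [mk ik] := sk.
have ma : measurable_fun D (fun x => a * h x + k x).
  by apply: measurable_funD => //; exact: measurable_funM.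
split=> //.
have := integrableD mD (integrableZl mD (a ^+ 2) ih)
  (integrableD mD (integrableZl mD (2 * a) (sq_integrableM sh sk)) ik).
apply: eq_integrable => // x _.
by rewrite /= -!EFinM -!EFinD; congr EFin; ring.
Qed.

Lemma sq_integrableZ a h : sq_integrable h -> sq_integrable (fun x => a * h x).
Proof.
(* [a * h] is written as [(a - 1) * h + h]. *)
move=> sh; have := sq_integrable_lin (a - 1) sh sh.
by congr sq_integrable; apply/funext => x; ring.
Qed.

Lemma sq_integrable_sum (I : Type) (s : seq I) (h : I -> T -> R) :
  (forall i, sq_integrable (h i)) -> sq_integrable (fun x => \sum_(i <- s) h i x).
Proof.
move=> sh; elim: s => [|i s IH].
  split; first by under eq_fun do rewrite big_nil; exact: measurable_cst.
  under eq_fun do rewrite big_nil expr2 mulr0; exact: integrable0.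
under eq_fun do rewrite big_cons -[X in X + _]mul1r.
exact: sq_integrable_lin.
Qed.

Variables m n : nat.
Implicit Types u v w : T -> 'M[R]_(m, n).

Lemma L2_mdot_integrable u v : L2 mu D u -> L2 mu D v ->
  mu.-integrable D (fun x => (mdot (u x) (v x))%:E).
Proof.
move=> Lu Lv.
pose h i j x : \bar R := (u x i j * v x i j)%:E.
have : mu.-integrable D (fun x => \sum_i \sum_j h i j x)%E.
  apply: integrable_sum => // i _; apply: integrable_sum => // j _.
  by apply: sq_integrableM; [exact: Lu|exact: Lv].
apply: eq_integrable => // x _; rewrite /mdot -sumEFin.
by apply: eq_bigr => i _; rewrite -sumEFin.
Qed.

Lemma L2_linear a u v : L2 mu D u -> L2 mu D v -> L2 mu D (a *: u + v).
Proof.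
move=> Lu Lv i j; have := sq_integrable_lin a (Lu i j) (Lv i j).
by congr sq_integrable; apply/funext => x; rewrite !mxE.
Qed.

Lemma L2dot_semi_inner : semi_inner (L2 mu D) (@L2dot R disp T mu D m n).
Proof.
split=> [a u v|a u v w Lu Lv Lw|u v _ _|u _]; first exact: L2_linear.
- rewrite /L2dot -RintegralZl//; last exact: L2_mdot_integrable.
  rewrite -RintegralD//; last 2 first.
  + exact: (integrableZl mD a (L2_mdot_integrable Lu Lw)).
  + exact: L2_mdot_integrable.
  by apply: eq_Rintegral => x _; rewrite -mdotDZl.
- by apply: eq_Rintegral => x _; rewrite mdotC.
- by apply: Rintegral_ge0 => x _; exact: mdot_ge0.
Qed.

Lemma L2dot_ae u u' v v' : L2 mu D u -> L2 mu D u' -> L2 mu D v -> L2 mu D v' ->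
  eq_ae_on mu D u u' -> eq_ae_on mu D v v' ->
  L2dot mu D u v = L2dot mu D u' v'.
Proof.
move=> Lu Lu' Lv Lv' uu' vv'; congr fine; apply: ae_eq_integral => //.
- by have /integrableP[] := L2_mdot_integrable Lu Lv.
- by have /integrableP[] := L2_mdot_integrable Lu' Lv'.
by apply: filterS2 uu' vv' => x uu' vv' Dx; rewrite uu'// vv'.
Qed.

Lemma L2norm_eq0 u : L2 mu D u -> L2norm mu D u = 0 -> eq_ae_on mu D u 0.
Proof.
move=> Lu /eqP; rewrite sqrtr_eq0 => u0.
have iu := L2_mdot_integrable Lu Lu.
have [mu0 _] := integrableP _ _ _ iu.
have /(ae_eq_integral_abs _ mD mu0) :
    (\int[mu]_(x in D) `|(mdot (u x) (u x))%:E| = 0)%E.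
  transitivity (\int[mu]_(x in D) (mdot (u x) (u x))%:E)%E.
    by apply: eq_integral => x _; rewrite gee0_abs// lee_fin mdot_ge0.
  rewrite -[LHS]fineK; last exact: integrable_fin_num.
  congr EFin; apply/eqP; rewrite eq_le u0; apply: Rintegral_ge0 => x _.
  exact: mdot_ge0.
by apply: filterS => x /[apply] -[/mdot_eq0].
Qed.

End L2_theory.

(** * Elasticity tensor, strain and H^1 *)

Section elasticity.
Variables (R : realType) (d : nat) (lam mu : R).
Implicit Types x y : 'M[R]_d.

Lemma elast_act_linear a x y :
  elast_act lam mu (a *: x + y) = a *: elast_act lam mu x + elast_act lam mu y.
Proof.
apply/matrixP => i j; rewrite !mxE mulr_sumr -big_split/=; apply: eq_bigr => k _.
rewrite mulr_sumr -big_split/=; apply: eq_bigr => l _; rewrite !mxE; ring.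
Qed.

Lemma mdot_elast_actE x y : mdot (elast_act lam mu x) y =
  \sum_i \sum_j \sum_k \sum_l elast lam mu i j k l * y i j * x k l.
Proof.
apply: eq_bigr => i _; apply: eq_bigr => j _; rewrite mxE mulr_suml.
by apply: eq_bigr => k _; rewrite mulr_suml; apply: eq_bigr => l _; rewrite mulrAC.
Qed.

(** Major symmetry [c_ijkl = c_klij], read off the isotropic formula. *)
Lemma elast_act_sym x y :
  mdot (elast_act lam mu x) y = mdot (elast_act lam mu y) x.
Proof.
rewrite !mdot_elast_actE pair_bigA/=.
under eq_bigr do rewrite pair_bigA/=.
rewrite exchange_big/= [RHS]pair_bigA/=; apply: eq_bigr => -[k l] _ /=.
rewrite pair_bigA/=; apply: eq_bigr => -[i j] _ /=.
rewrite /elast [j == l]eq_sym [i == k]eq_sym [j == k]eq_sym [i == l]eq_sym; ring.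
Qed.

(** Minor symmetry in the last index pair; the next lemma is the one in the first pair. *)
Lemma elast_act_trmx x : elast_act lam mu x^T = elast_act lam mu x.
Proof.
apply/matrixP => i j; rewrite !mxE exchange_big/=; apply: eq_bigr => k _.
apply: eq_bigr => l _; rewrite mxE /elast [l == k]eq_sym; ring.
Qed.

Lemma trmx_elast_act x : (elast_act lam mu x)^T = elast_act lam mu x.
Proof.
apply/matrixP => i j; rewrite !mxE; apply: eq_bigr => k _.
apply: eq_bigr => l _; rewrite /elast [j == i]eq_sym; ring.
Qed.

Lemma mdot_trmx m n (A B : 'M[R]_(m, n)) : mdot A^T B^T = mdot A B.
Proof.
rewrite /mdot exchange_big/=; apply: eq_bigr => i _; apply: eq_bigr => j _.
by rewrite !mxE.
Qed.

(** Positivity is assumed on symmetric matrices, while the form is used on all of them. By the minor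
    symmetries its value at [x + x^T] is four times its value at [x]. *)
Lemma elast_act_ge0 x : elast_positive d lam mu ->
  0 <= mdot (elast_act lam mu x) x.
Proof.
move=> [c [c0 cP]]; pose s : 'M[R]_d := x + x^T.
have sT : s^T = s by rewrite /s linearD/= trmxK addrC.
have : 0 <= mdot (elast_act lam mu s) s.
  rewrite mdot_elast_actE; apply: le_trans (cP s sT).
  by rewrite mulr_ge0 ?sqr_ge0// ltW.
have -> : elast_act lam mu s = 2 *: elast_act lam mu x.
  by rewrite /s -[x in x + _]scale1r elast_act_linear elast_act_trmx scale1r scalerDl scale1r.
have h : mdot (elast_act lam mu x) x^T = mdot (elast_act lam mu x) x.
  by rewrite -{1}trmx_elast_act mdot_trmx.
have S := @mdot_semi_inner R d d.
rewrite (semi_inner_scalel S)// (semi_inner_addr S)// h; lra.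
Qed.

Lemma elast_act_bounded : exists2 K, 0 <= K &
  forall x, mdot (elast_act lam mu x) x <= K * mdot x x.
Proof.
exists (\sum_(i < d) \sum_(j < d) \sum_(k < d) \sum_(l < d) `|elast lam mu i j k l|).
  by do 4! apply: sumr_ge0 => ? _.
move=> x; rewrite mdot_elast_actE.
do 4! (rewrite mulr_suml; apply: ler_sum => ? _).
apply: le_trans (ler_norm _) _; rewrite -mulrA normrM ler_wpM2l// normrM.
rewrite -[leRHS]sqr_sqrtr ?mdot_ge0// expr2.
by apply: ler_pM => //; exact: coord_le_enorm.
Qed.

Context (disp : measure_display) (T : measurableType disp).
Variables (P : {measure set T -> \bar R}) (D : set T).
Hypothesis mD : measurable D.
Implicit Types u v w : T -> 'M[R]_d.

Definition C_act u : T -> 'M[R]_d := fun t => elast_act lam mu (u t).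

Lemma C_act_linear a u v : C_act (a *: u + v) = a *: C_act u + C_act v.
Proof. by apply/funext => t; rewrite /C_act elast_act_linear. Qed.

Lemma L2_C_act u : L2 P D u -> L2 P D (C_act u).
Proof.
move=> Lu i j.
have : sq_integrable P D (fun t => \sum_k \sum_l elast lam mu i j k l * u t k l).
  apply: sq_integrable_sum => // k; apply: sq_integrable_sum => // l.
  by apply: sq_integrableZ => //; exact: Lu.
by congr sq_integrable; apply/funext => t; rewrite mxE.
Qed.

Definition Cdot u v : R := L2dot P D (C_act u) v.

Lemma Cdot_semi_inner : elast_positive d lam mu -> semi_inner (L2 P D) Cdot.
Proof.
move=> Cpos; have LS := L2dot_semi_inner P mD d d.
split=> [a u v|a u v w Lu Lv Lw|u v _ _|u _]; first exact: L2_linear.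
- rewrite /Cdot C_act_linear (semi_inner_lin LS)//; exact: L2_C_act.
- by apply: eq_Rintegral => t _; rewrite elast_act_sym.
- by apply: Rintegral_ge0 => t _; exact: elast_act_ge0.
Qed.

Lemma Cdot_bounded : exists2 K, 0 <= K &
  forall u, L2 P D u -> Cdot u u <= K * L2norm P D u ^+ 2.
Proof.
have [K K0 KP] := elast_act_bounded; exists K => // u Lu.
have LS := L2dot_semi_inner P mD d d.
rewrite (seminorm_sqr LS)// /L2dot -RintegralZl//; last exact: L2_mdot_integrable.
apply: le_Rintegral => //.
- by apply: L2_mdot_integrable => //; exact: L2_C_act.
- exact: (integrableZl mD K (L2_mdot_integrable mD Lu Lu)).
- by move=> t _; exact: KP.
Qed.

End elasticity.

Section strain.
Variables (R : realType) (d : nat) (Omega : set 'rV[R]_d).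
Hypothesis mO : (leb_outer R d).-caratheodory Omega.
Implicit Types u v : vfield R d.

Lemma strain_linear a u v : strain (a *: u + v) = a *: strain u + strain v.
Proof.
apply/funext => x; apply/matrixP => i j.
have -> : (a *: strain u + strain v) x = a *: strain u x + strain v x by [].
rewrite /strain !mxE; ring.
Qed.

Lemma strain_sub u v : strain (u - v) = strain u - strain v.
Proof. by rewrite addrC -scaleN1r strain_linear scaleN1r addrC. Qed.

Lemma L2_trmx m n (G : 'rV[R]_d -> 'M[R]_(m, n)) :
  L2 (Lebesgue R d) Omega G -> L2 (Lebesgue R d) Omega (fun x => (G x)^T).
Proof.
move=> LG i j; have := LG j i.
by congr (sq_integrable _ _ _); apply/funext => x /=; rewrite mxE.
Qed.

Let LS := L2dot_semi_inner (Lebesgue R d) mO d d.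

Lemma L2_strain u : L2 (Lebesgue R d) Omega u.2 ->
  L2 (Lebesgue R d) Omega (strain u).
Proof.
move=> Lu; exact: (semi_innerZ LS 2^-1 (semi_innerD LS Lu (L2_trmx Lu))).
Qed.

(** Transposition is an isometry, so averaging with the transpose cannot increase the norm. *)
Lemma L2norm_strain u : L2 (Lebesgue R d) Omega u.2 ->
  L2norm (Lebesgue R d) Omega (strain u) <= L2norm (Lebesgue R d) Omega u.2.
Proof.
move=> Lu; have LuT := L2_trmx Lu.
have := seminormZ LS 2^-1 (semi_innerD LS Lu LuT).
rewrite ger0_norm ?invr_ge0// => strainE; rewrite [leLHS]strainE.
have := seminormD LS Lu LuT.
have -> : L2dot (Lebesgue R d) Omega (fun x => (u.2 x)^T) (fun x => (u.2 x)^T) =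
  L2dot (Lebesgue R d) Omega u.2 u.2.
  by apply: eq_Rintegral => x _; rewrite mdot_trmx.
rewrite /L2norm; lra.
Qed.

End strain.

Section bounded_open.
Variables (R : realType) (d : nat) (Omega : set 'rV[R]_d).
Hypotheses (oO : open Omega) (bO : bounded_set Omega).

(** A continuous function is bounded on a compact cube containing [Omega], which has finite measure.
    Applied to constants, test functions and their first derivatives. *)
Lemma continuous_sq_integrable (h : 'rV[R]_d -> R) :
  continuous h -> sq_integrable (Lebesgue R d) Omega h.
Proof.
move=> ch; split; first exact: continuous_leb_measurable.
apply: measurable_bounded_integrable; first exact: leb_open.
- exact: leb_bounded.
- by apply: measurable_funM; exact: continuous_leb_measurable.
have [M [Mr OM]] := bO.
have cK : compact [set v : 'rV[R]_d | forall i, v ord0 i \in `[- (M + 1), M + 1]].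
  apply: (@rV_compact _ _ (fun=> `[- (M + 1), M + 1]%classic)) => _.
  exact: segment_compact.
have : compact (h @` [set v : 'rV[R]_d | forall i, v ord0 i \in `[- (M + 1), M + 1]]).
  apply: continuous_compact => //; exact: continuous_subspaceT.
move=> /compact_bounded [N [Nr hN]].
exists ((`|N| + 1) ^+ 2); split; first exact: num_real.
move=> z Nz x Ox /=.
have hx : `|h x| <= `|N| + 1.
  apply: hN; first by rewrite ltr_pwDr// ler_norm.
  exists x => // i; rewrite in_itv/= -ler_norml.
  by apply: le_trans (coord_le_norm _ _ _) _; apply: OM => //; rewrite ltrDl.
rewrite normrX (le_trans _ (ltW Nz))// lerXn2r// ?nnegrE ?addr_ge0//.
Qed.

(** The defining integrals add because each integrand is a product of two square-integrable
    functions. *)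
Lemma weak_gradient_linear a (u v : vfield R d) : H1 Omega u -> H1 Omega v ->
  weak_gradient Omega (a *: u + v).1 (a *: u + v).2.
Proof.
move=> [Lu1 Lu2 Wu] [Lv1 Lv2 Wv] th tth i j.
have mO : measurable (Omega : set (caratheodory_type (leb_outer R d))).
  exact: leb_open.
have [sth _ _] := tth.
have s0 : sq_integrable (Lebesgue R d) Omega th.
  by apply: continuous_sq_integrable; have [] := sth [::].
have sj : sq_integrable (Lebesgue R d) Omega ('D_(delta_mx 0 j) th).
  by apply: continuous_sq_integrable; have [] := sth [:: j].
have step (k h1 h2 : 'rV[R]_d -> R) : sq_integrable (Lebesgue R d) Omega k ->
    sq_integrable (Lebesgue R d) Omega h1 -> sq_integrable (Lebesgue R d) Omega h2 ->
    \int[Lebesgue R d]_(x in Omega) ((a * h1 x + h2 x) * k x) =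
    a * \int[Lebesgue R d]_(x in Omega) (h1 x * k x) +
    \int[Lebesgue R d]_(x in Omega) (h2 x * k x).
  move=> sk s1 s2; have i1 := sq_integrableM mO s1 sk; have i2 := sq_integrableM mO s2 sk.
  rewrite -RintegralZl// -RintegralD//; last exact: (integrableZl mO a i1).
  by apply: eq_Rintegral => x _; ring.
transitivity (\int[Lebesgue R d]_(x in Omega)
   ((a * u.1 x 0 i + v.1 x 0 i) * 'D_(delta_mx 0 j) th x)).
  by apply: eq_Rintegral => x _; rewrite !mxE.
rewrite (step _ _ _ sj (Lu1 0 i) (Lv1 0 i)) (Wu _ tth) (Wv _ tth).
rewrite mulrN -opprD -(step _ _ _ s0 (Lu2 i j) (Lv2 i j)).
by congr (- _); apply: eq_Rintegral => x _; rewrite !mxE.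
Qed.

Definition H1dot (u v : vfield R d) : R :=
  L2dot (Lebesgue R d) Omega u.1 v.1 + L2dot (Lebesgue R d) Omega u.2 v.2.

Lemma H1_semi_inner : semi_inner (H1 Omega) H1dot.
Proof.
have mO := leb_open oO.
have S1 := L2dot_semi_inner (Lebesgue R d) mO 1 d.
have S2 := L2dot_semi_inner (Lebesgue R d) mO d d.
split=> [a u v Hu Hv|a u v w [? ? _] [? ? _] [? ? _]|u v [? ? _] [? ? _]|u [? ? _]].
- have [Lu1 Lu2 _] := Hu; have [Lv1 Lv2 _] := Hv.
  split; [exact: (semi_innerP S1)|exact: (semi_innerP S2)|].
  exact: weak_gradient_linear.
- by rewrite /H1dot /= (semi_inner_lin S1)// (semi_inner_lin S2)//; ring.
- by rewrite /H1dot (semi_innerC S1)// (semi_innerC S2).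
- by rewrite addr_ge0// ?(semi_inner_ge0 S1)// (semi_inner_ge0 S2).
Qed.

Lemma H1normE u : H1 Omega u -> H1norm Omega u = Num.sqrt (H1dot u u).
Proof.
have mO := leb_open oO; move=> [L1 L2' _]; congr Num.sqrt; congr (_ + _).
  exact: (seminorm_sqr (L2dot_semi_inner (Lebesgue R d) mO 1 d)).
exact: (seminorm_sqr (L2dot_semi_inner (Lebesgue R d) mO d d)).
Qed.

End bounded_open.

(** * Traces and loads *)

Lemma enorm_continuous (R : realType) m n (c : 'M[R]_(m, n)) :
  continuous (fun A : 'M[R]_(m, n) => enorm (A - c)).
Proof.
move=> A.
suff h : (fun B : 'M[R]_(m, n) => mdot (B - c) (B - c)) @ A --> mdot (A - c) (A - c).
  exact: (continuous_cvg _ (@sqrt_continuous R _) h).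
have FA : Filter (nbhs A) by exact: nbhs_filter.
apply: (cvg_big (@add_continuous _)) => i _.
apply: (cvg_big (@add_continuous _)) => j _.
have h : (fun B : 'M[R]_(m, n) => (B - c) i j) @ A --> (A - c) i j.
  under eq_fun do rewrite !mxE; rewrite !mxE.
  by apply: cvgB; [exact: coord_continuous|exact: cvg_cst].
exact: cvgM.
Qed.

(** The topology comes from the sup norm, whereas traces average over Euclidean balls; continuity of
    [enorm] reconciles the two. *)
Lemma eball_open (R : realType) d (x : 'rV[R]_d) r : open (eball x r).
Proof.
have -> : eball x r = (fun y : 'rV[R]_d => enorm (y - x)) @^-1` [set t | t < r] by [].
by apply: open_comp => [y _|]; [exact: enorm_continuous|exact: open_lt].
Qed.

Lemma ae_imply disp (T : measurableType disp) (R : realType)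
    (mu : {measure set T -> \bar R}) (P Q : T -> Prop) :
  (forall x, P x -> Q x) -> {ae mu, forall x, P x} -> {ae mu, forall x, Q x}.
Proof. by move=> PQ; apply: filterS. Qed.

Lemma ae_imply2 disp (T : measurableType disp) (R : realType)
    (mu : {measure set T -> \bar R}) (P Q S : T -> Prop) :
  (forall x, P x -> Q x -> S x) ->
  {ae mu, forall x, P x} -> {ae mu, forall x, Q x} -> {ae mu, forall x, S x}.
Proof. by move=> PQS; apply: filterS2. Qed.

Section trace.
Variables (R : realType) (d : nat) (Omega : set 'rV[R]_d.+1).
Hypotheses (oO : open Omega) (bO : bounded_set Omega).
Implicit Types v w tau : 'rV[R]_d.+1 -> 'rV[R]_d.+1.

Let Leb := Lebesgue R d.+1.
Let B x r : set (caratheodory_type (leb_outer R d.+1)) := eball x r `&` Omega.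
Let mO : measurable (Omega : set (caratheodory_type (leb_outer R d.+1))) :=
  leb_open oO.

Definition ball_mean v (c x : 'rV[R]_d.+1) (r : R) : R :=
  (fine (leb (B x r)))^-1 * \int[Leb]_(y in B x r) enorm (v y - c).

Let mB x r : measurable (B x r).
Proof. by apply: leb_open; apply: openI => //; exact: eball_open. Qed.

(** A boundary point lies in the closure, so the ball meets [Omega] in a nonempty open set.
    Finiteness matters as well, since [fine] sends [+oo] to 0. *)
Lemma ball_leb_gt0 x r : bdry Omega x -> 0 < r -> 0 < fine (leb (B x r)).
Proof.
move=> [clx _] r0; apply: fine_gt0; apply/andP; split.
  apply: leb_open_gt0; first by apply: openI => //; exact: eball_open.
  rewrite /B setIC; apply: clx; apply: open_nbhs_nbhs; split; first exact: eball_open.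
  by rewrite /eball/= subrr /enorm (seminorm0 (@mdot_semi_inner R 1 d.+1)).
apply: le_lt_trans (leb_bounded bO); apply: le_outer_measure; exact: subIsetr.
Qed.

Lemma enorm_integrable v c x r : L2 Leb Omega v ->
  Leb.-integrable (B x r) (fun y => (enorm (v y - c))%:E).
Proof.
move=> Lv.
suff : Leb.-integrable Omega (fun y => (enorm (v y - c))%:E).
  by apply: integrableS => //; exact: subIsetr.
have LS := L2dot_semi_inner Leb mO 1 d.+1.
have Lc : L2 Leb Omega (fun=> c).
  by move=> i j; apply: continuous_sq_integrable => //; exact: cst_continuous.
have Lvc : L2 Leb Omega (fun y => v y - c) := semi_innerB LS Lv Lc.
have i1 := L2_mdot_integrable mO Lvc Lvc.
have s1 : sq_integrable Leb Omega (fun=> 1).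
  by apply: continuous_sq_integrable => //; exact: cst_continuous.
(* The Euclidean norm is at most its square plus 1, and 1 is integrable over the bounded set
   [Omega]. *)
apply: (le_integrable mO _ _ (integrableD mO i1 (sq_integrableM mO s1 s1))).
  have /integrableP[/measurable_EFinP mi1 _] := i1.
  apply/measurable_EFinP.
  exact: (measurableT_comp (continuous_measurable_fun (@sqrt_continuous R)) mi1).
move=> y _.
change (`|(enorm (v y - c))%:E| <= `|(mdot (v y - c) (v y - c) + 1 * 1)%:E|)%E.
rewrite !abse_EFin lee_fin; have := mdot_ge0 (v y - c) => m0.
rewrite !ger0_norm ?sqrtr_ge0 ?addr_ge0// ?mulr1//.
have := sqr_sqrtr m0; have := sqrtr_ge0 (mdot (v y - c) (v y - c)).
rewrite -/(enorm _); nra.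
Qed.

Lemma ball_mean_ge0 v c x r : 0 <= ball_mean v c x r.
Proof.
apply: mulr_ge0; first by rewrite invr_ge0 fine_ge0// (outer_measure_ge0 (leb_outer R d.+1)).
by apply: Rintegral_ge0 => y _; exact: sqrtr_ge0.
Qed.

Lemma ball_mean_sub v w c c' x r : L2 Leb Omega v -> L2 Leb Omega w ->
  ball_mean (v - w) (c - c') x r <= ball_mean v c x r + ball_mean w c' x r.
Proof.
move=> Lv Lw; rewrite /ball_mean -mulrDr ler_wpM2l//.
  by rewrite invr_ge0 fine_ge0// (outer_measure_ge0 (leb_outer R d.+1)).
have LS := L2dot_semi_inner Leb mO 1 d.+1.
have iv := enorm_integrable c x r Lv.
have iw := enorm_integrable c' x r Lw.
rewrite -RintegralD//; apply: le_Rintegral => //.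
- exact: enorm_integrable (semi_innerB LS Lv Lw).
- exact: (integrableD (mB x r) iv iw).
move=> y _; have S := @mdot_semi_inner R 1 d.+1.
have -> : (v - w) y - (c - c') = (v y - c) - (w y - c')
  by rewrite !fctE; apply/matrixP => i j; rewrite !mxE; ring.
rewrite /enorm (le_trans (seminormD S I I))// lerD2l.
by rewrite -scaleN1r (seminormZ S)// normrN1 mul1r.
Qed.

Lemma ball_mean_ae v w c x r : L2 Leb Omega v -> L2 Leb Omega w ->
  eq_ae_on Leb Omega v w -> ball_mean v c x r = ball_mean w c x r.
Proof.
move=> Lv Lw vw; rewrite /ball_mean /Rintegral.
have -> // : (\int[Leb]_(y in B x r) (enorm (v y - c))%:E =
              \int[Leb]_(y in B x r) (enorm (w y - c))%:E)%E.
apply: ae_eq_integral; first exact: mB.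
- by have /integrableP[] := enorm_integrable c x r Lv.
- by have /integrableP[] := enorm_integrable c x r Lw.
by apply: ae_imply vw => y vw [_ Oy]; rewrite vw.
Qed.

Lemma is_traceE v tau : is_trace Omega v tau <->
  L2 (Surface R d.+1) (bdry Omega) tau /\
  {ae Surface R d.+1, forall x : 'rV[R]_d.+1, bdry Omega x ->
    ball_mean v (tau x) x r @[r --> 0^'+] --> (0 : R)}.
Proof. by []. Qed.

Lemma bdry_measurable :
  measurable (bdry Omega : set (caratheodory_type (surface_outer R d.+1))).
Proof.
apply: caratheodory_measurable_setD.
  by apply: surface_closed; exact: closed_closure.
by apply: surface_open; exact: open_interior.
Qed.

(** The triangle inequality under the mean squeezes the new mean between 0 and the sum of two
    vanishing ones. *)
Lemma is_trace_sub v w tau tau' : L2 Leb Omega v -> L2 Leb Omega w ->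
  is_trace Omega v tau -> is_trace Omega w tau' ->
  is_trace Omega (v - w) (tau - tau').
Proof.
move=> Lv Lw /is_traceE[Lt vt] /is_traceE[Lt' wt].
apply/is_traceE; split.
  exact: (semi_innerB (L2dot_semi_inner _ bdry_measurable 1 d.+1)).
apply: ae_imply2 vt wt => x vt wt bx.
have vw0 : ball_mean v (tau x) x r + ball_mean w (tau' x) x r @[r --> (0:R)^'+] --> (0:R).
  by rewrite -[X in _ --> X]addr0; apply: cvgD; [exact: vt|exact: wt].
apply: (squeeze_cvgr _ (cvg_cst (0 : R)) vw0); near=> r.
by rewrite ball_mean_ge0 ball_mean_sub.
Unshelve. all: by end_near. Qed.

Lemma is_trace_ae v w tau : L2 Leb Omega v -> L2 Leb Omega w ->
  eq_ae_on Leb Omega v w -> is_trace Omega v tau -> is_trace Omega w tau.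
Proof.
move=> Lv Lw vw /is_traceE[Lt vt]; apply/is_traceE; split; first exact: Lt.
apply: ae_imply vt => x vt bx; have := vt bx.
by have -> : ball_mean w (tau x) x = ball_mean v (tau x) x;
  first by apply/funext => r; rewrite (ball_mean_ae _ _ _ Lv Lw vw).
Qed.

Lemma is_trace00 : is_trace Omega 0 0.
Proof.
apply/is_traceE; split.
  have LS := L2dot_semi_inner (Surface R d.+1) bdry_measurable 1 d.+1.
  move=> i j; split; first by under eq_fun do rewrite mxE; exact: measurable_cst.
  by under eq_fun do rewrite mxE expr2 mulr0; exact: integrable0.
apply: aeW => x _; rewrite /ball_mean.
have -> : (fun r => (fine (leb (B x r)))^-1 * \int[Leb]_(y in B x r)
   enorm ((0 : 'rV[R]_d.+1 -> 'rV[R]_d.+1) y - (0 : 'rV[R]_d.+1 -> 'rV[R]_d.+1) x)) = (fun=> 0).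
  apply/funext => r.
  under eq_Rintegral do rewrite subrr /enorm (seminorm0 (@mdot_semi_inner R 1 d.+1))//.
  by rewrite Rintegral_cst// mul0r mulr0.
exact: cvg_cst.
Qed.

(** For the zero field the mean is independent of [r > 0]: it equals [enorm (tau x)], the volume
    being positive and finite. Its limit 0 is therefore its value. *)
Lemma is_trace0_eq0 tau : is_trace Omega 0 tau ->
  eq_ae_on (Surface R d.+1) (bdry Omega) tau 0.
Proof.
move=> /is_traceE[Lt tt]; apply: ae_imply tt => x tt bx.
have S := @mdot_semi_inner R 1 d.+1.
have : enorm (tau x) @[r --> (0:R)^'+] --> (0 : R).
  apply: cvg_trans (tt bx); apply: near_eq_cvg; near=> r.
  have r0 : 0 < r by near: r; exact: nbhs_right_gt.
  rewrite /ball_mean.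
  under eq_Rintegral do rewrite sub0r /enorm -scaleN1r (seminormZ S)// normrN1 mul1r.
  rewrite Rintegral_cst// mulrCA -[fine (_ (B x r))]/(fine (leb (B x r))).
  by rewrite mulVf ?mulr1// gt_eqF// ball_leb_gt0.
move=> taux0; have e0 : enorm (tau x) = 0.
  exact: (cvg_unique (@Rhausdorff R) (cvg_cst _) taux0).
apply: mdot_eq0; apply/eqP; rewrite eq_le mdot_ge0 andbT.
by rewrite -sqrtr_eq0 -/(enorm _) e0.
Unshelve. all: by end_near. Qed.

Lemma is_trace_unique v tau tau' : L2 Leb Omega v ->
  is_trace Omega v tau -> is_trace Omega v tau' ->
  eq_ae_on (Surface R d.+1) (bdry Omega) tau tau'.
Proof.
move=> Lv vt vt'; have := is_trace_sub Lv Lv vt vt'; rewrite subrr.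
by move=> /is_trace0_eq0; apply: ae_imply => x /[apply] /subr0_eq.
Qed.

End trace.

Lemma L2_subset (R : realType) disp (T : measurableType disp)
    (mu : {measure set T -> \bar R}) (D E : set T) m n (v : T -> 'M[R]_(m, n)) :
  measurable D -> measurable E -> D `<=` E -> L2 mu E v -> L2 mu D v.
Proof.
move=> mD mE DE Lv i j; have [mv iv] := Lv i j.
by split; [exact: measurable_funS mv|exact: integrableS iv].
Qed.

Lemma eq_ae_on_refl (R : realType) disp (T : measurableType disp)
    (mu : {measure set T -> \bar R}) (D : set T) m n (v : T -> 'M[R]_(m, n)) :
  eq_ae_on mu D v v.
Proof. exact: aeW. Qed.

Section load.
Variables (R : realType) (d : nat) (Omega Gamma0 Gamma1 : set 'rV[R]_d.+1).
Hypotheses (oO : open Omega) (bO : bounded_set Omega).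
Hypotheses (Gamma0_bdry : Gamma0 `<=` bdry Omega)
  (Gamma1_bdry : Gamma1 `<=` bdry Omega)
  (mGamma1 : measurable (Gamma1 : set (caratheodory_type (surface_outer R d.+1)))).
Implicit Types v w g : vfield R d.+1.

Let Leb := Lebesgue R d.+1.
Let Surf := Surface R d.+1.
Let mO : measurable (Omega : set (caratheodory_type (leb_outer R d.+1))) :=
  leb_open oO.

(** [trace] falls back to 0 when no trace exists, so a witness is required; membership in [Vspace]
    supplies one. *)
Lemma trace_is_trace (v tau : 'rV[R]_d.+1 -> 'rV[R]_d.+1) :
  is_trace Omega v tau -> is_trace Omega v (trace Omega v).
Proof. by move=> vt; apply: xgetPex; exists tau. Qed.

Lemma trace_L2 (v tau : 'rV[R]_d.+1 -> 'rV[R]_d.+1) :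
  is_trace Omega v tau -> L2 Surf Gamma1 tau.
Proof.
move=> [Lt _]; apply: L2_subset Lt => //; exact: bdry_measurable.
Qed.

(** Representatives for [v], [w] and [v - w] are chosen independently, so linearity of the surface
    term rests on a.e. uniqueness of traces. *)
Lemma load_sub (f q : 'rV[R]_d.+1 -> 'rV[R]_d.+1) v w tau tau' :
  L2 Leb Omega f -> L2 Surf Gamma1 q -> H1 Omega v -> H1 Omega w ->
  is_trace Omega v.1 tau -> is_trace Omega w.1 tau' ->
  load Omega Gamma1 f q (v - w) = load Omega Gamma1 f q v - load Omega Gamma1 f q w.
Proof.
move=> Lf Lq [Lv _ _] [Lw _ _] /trace_is_trace vt /trace_is_trace wt.
have vwt := is_trace_sub oO bO Lv Lw vt wt.
have SL := L2dot_semi_inner Leb mO 1 d.+1.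
have SS := L2dot_semi_inner Surf mGamma1 1 d.+1.
have Lvw : L2 Leb Omega (v - w).1 := semi_innerB SL Lv Lw.
have ttr := is_trace_unique oO bO Lvw (trace_is_trace vwt) vwt.
have trE : L2dot Surf Gamma1 q (trace Omega (v - w).1) =
    L2dot Surf Gamma1 q (trace Omega v.1 - trace Omega w.1).
  apply: (L2dot_ae mGamma1 Lq Lq (trace_L2 (trace_is_trace vwt)) (trace_L2 vwt)
    (eq_ae_on_refl _ _ _)).
  by apply: ae_imply ttr => x tt /Gamma1_bdry /tt.
have fE := semi_inner_subr SL Lv Lw Lf.
have qE := semi_inner_subr SS (trace_L2 vt) (trace_L2 wt) Lq.
have addB (a b a' b' : R) : (a - b) + (a' - b') = (a + a') - (b + b') by ring.
exact: etrans (congr2 +%R fE (etrans trE qE)) (addB _ _ _ _).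
Qed.

Lemma load_ae (f f' q q' : 'rV[R]_d.+1 -> 'rV[R]_d.+1) v tau :
  L2 Leb Omega f -> L2 Leb Omega f' -> L2 Surf Gamma1 q -> L2 Surf Gamma1 q' ->
  H1 Omega v -> is_trace Omega v.1 tau ->
  eq_ae_on Leb Omega f f' -> eq_ae_on Surf Gamma1 q q' ->
  load Omega Gamma1 f q v = load Omega Gamma1 f' q' v.
Proof.
move=> Lf Lf' Lq Lq' [Lv _ _] /trace_is_trace vt ff' qq'.
have tL := trace_L2 vt.
have fE := L2dot_ae mO Lf Lf' Lv Lv ff' (eq_ae_on_refl _ _ _).
exact: congr2 fE (L2dot_ae mGamma1 Lq Lq' tL tL qq' (eq_ae_on_refl _ _ _)).
Qed.

(** The two memberships may use different representatives [tg] and [tg'] of the trace of [g];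
    uniqueness identifies them a.e. on [Gamma0]. *)
Lemma Vspace_sub g v w : H1 Omega g -> Vspace Omega Gamma0 g v ->
  Vspace Omega Gamma0 g w -> Vspace Omega Gamma0 0 (v - w).
Proof.
move=> [Lg _ _] [Hv [tv [tg [vt gt tvg]]]] [Hw [tw [tg' [wt gt' twg]]]].
split; first exact: (semi_innerB (H1_semi_inner oO bO)).
have [[Lv _ _] [Lw _ _]] := (Hv, Hw).
exists (tv - tw), 0; split; first exact: (is_trace_sub oO bO Lv Lw vt wt).
  exact: is_trace00.
have tgg' := is_trace_unique oO bO Lg gt gt'.
have tvtg' : eq_ae_on Surf Gamma0 tv tg'.
  by apply: ae_imply2 tvg tgg' => x vg gg' G0; rewrite vg// gg'//; exact: Gamma0_bdry.
apply: ae_imply2 tvtg' twg => x vg wg G0.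
have e : tv x = tw x by rewrite vg// wg.
by apply: etrans (subrr (tw x : 'rV[R]_d.+1)); rewrite -{1}e.
Qed.

Lemma Vspace_ae g g' v : H1 Omega g -> H1 Omega g' -> eq_ae_on Leb Omega g.1 g'.1 ->
  Vspace Omega Gamma0 g v -> Vspace Omega Gamma0 g' v.
Proof.
move=> [Lg _ _] [Lg' _ _] gg' [Hv [tv [tg [vt gt tvg]]]].
split; first exact: Hv.
by exists tv, tg; split; [exact: vt|exact: (is_trace_ae oO bO Lg Lg' gg' gt)|exact: tvg].
Qed.

End load.

(** * Derivatives of paths *)

Lemma is_derive_of_bound (R : realType) (F r : R -> R) (x L : R) :
  (\forall h \near (0 : R)^', `|F (h + x) - F x - h * L| <= `|h| * r h) ->
  r h @[h --> (0 : R)^'] --> (0 : R) -> is_derive x 1 F L.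
Proof.
move=> bound r0.
have quot : h^-1 *: ((F \o shift x) (h *: 1) - F x) @[h --> (0:R)^'] --> L.
  apply/cvgrPdist_lt => e e0; near=> h.
  have h0 : h != 0 by near: h; exact: nbhs_dnbhs_neq.
  have rh : r h < e by near: h; exact: (cvgr_lt 0).
  apply: le_lt_trans rh; rewrite distrC.
  have -> : h^-1 *: ((F \o shift x) (h *: 1) - F x) - L =
      h^-1 * (F (h + x) - F x - h * L).
    by rewrite /= [h *: 1]mulr1 mulrBr mulrA mulVf// mul1r.
  rewrite normrM normfV ler_pdivrMl ?normr_gt0//.
  by near: h.
apply: DeriveDef; first by apply/cvg_ex; exists L.
exact: (cvg_lim (@Rhausdorff R) quot).
Unshelve. all: by end_near. Qed.

Lemma cvg_absM (R : realType) (k : R -> R) (l : R) :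
  k h @[h --> (0 : R)^'] --> l -> `|h| * k h @[h --> (0 : R)^'] --> (0 : R).
Proof.
move=> kl; rewrite -[X in _ --> X](mul0r l); apply: cvgM kl.
rewrite -[X in _ --> X](@normr0 _ R); apply: cvg_norm.
exact: cvg_within.
Qed.

(** At an interior point the restriction to [[0, T]] is automatic once [|h|] is below [x] and
    [T - x], so the limit is two-sided. *)
Lemma within_dnbhs_shift (R : realType) (k : R -> R) (T x l : R) :
  x \in `]0, T[ -> k s @[s --> within `[0, T] x^'] --> l ->
  k (h + x) @[h --> (0 : R)^'] --> l.
Proof.
rewrite in_itv/= => /andP[x0 xT] kl A /kl /=.
rewrite /within/= => /nbhs_ballP[e /= e0 eA].
apply/nbhs_ballP; exists (Num.min e (Num.min x (T - x))).
  by rewrite /= !lt_min e0 x0 subr_gt0 xT.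
move=> h /=; rewrite /ball/= sub0r normrN !lt_min => /and3P[he hx hT] h0.
move: hx hT; rewrite !ltr_norml => /andP[hx _] /andP[_ hT].
apply: eA => /=.
- by rewrite /ball/= opprD addrCA subrr addr0 normrN.
- by rewrite -subr_eq0 addrK.
- by rewrite in_itv/=; lra.
Qed.

Lemma near_shift_itv (R : realType) (T x : R) : x \in `]0, T[ ->
  \forall h \near (0 : R)^', h + x \in `]0, T[.
Proof.
rewrite in_itv/= => /andP[x0 xT].
apply/nbhs_ballP; exists (Num.min x (T - x)).
  by rewrite /= lt_min x0 subr_gt0 xT.
move=> h; rewrite /ball/= sub0r normrN lt_min !ltr_norml in_itv/=; lra.
Qed.

Lemma itv_derive0_const (R : realType) (T : R) (F : R -> R) :
  (forall x, x \in `]0, T[ -> is_derive x 1 F 0) ->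
  forall s t, s \in `]0, T[ -> t \in `]0, T[ -> F s = F t.
Proof.
move=> dF.
have le_const s t : s \in `]0, T[ -> t \in `]0, T[ -> s <= t -> F s = F t.
  rewrite !in_itv/= => /andP[s0 sT] /andP[t0 tT] st.
  have st0T x : x \in `[s, t] -> x \in `]0, T[.
    rewrite !in_itv/= => /andP[sx xt].
    by rewrite (lt_le_trans s0 sx) (le_lt_trans xt tT).
  have dst x : x \in `]s, t[ -> is_derive x 1 F ((fun=> 0) x).
    by move=> xst; apply: dF; apply: st0T; exact: subset_itv_oo_cc.
  have cst : {within `[s, t], continuous F}.
    by apply: derivable_within_continuous => x /st0T xT; have [] := dF x xT.
  have [c _ /eqP] := MVT_segment st dst cst.
  by rewrite mul0r subr_eq0 => /eqP.
move=> s t sT tT; have [st|/ltW ts] := leP s t; first exact: le_const.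
by apply/esym; exact: le_const.
Qed.

(** Reduces to the scalar mean value theorem: by the reverse triangle inequality the difference
    quotients of [N (w x - w t)] in [x] are bounded by the seminorms of those of [w], so this
    function is constant, and it is 0 at [x = t]. *)
Lemma time_derivative0_const (R : realType) (V : lmodType R) (S : V -> Prop)
    (b : V -> V -> R) (N : V -> R) (T : R) (w : R -> V) :
  semi_inner S b -> (forall v, S v -> N v = Num.sqrt (b v v)) ->
  (forall t, t \in `[0, T] -> S (w t)) ->
  time_derivative N T w (fun=> 0) ->
  forall s t, s \in `]0, T[ -> t \in `]0, T[ -> N (w s - w t) = 0.
Proof.
move=> Sb NE Sw dw s t sT tT.
have oc x : x \in `]0, T[ -> x \in `[0, T] by exact: subset_itv_oo_cc.
have SwB x y : x \in `[0, T] -> y \in `[0, T] -> S (w x - w y).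
  by move=> xT yT; apply: (semi_innerB Sb); exact: Sw.
have -> : N (w s - w t) = N (w t - w t).
  apply: (@itv_derive0_const _ T (fun x => N (w x - w t))) => // x xT.
  have := within_dnbhs_shift xT (dw x (oc x xT)).
  apply: is_derive_of_bound; near=> h.
  have h0 : h != 0 by near: h; exact: nbhs_dnbhs_neq.
  have hxT : h + x \in `[0, T] by apply: oc; near: h; exact: near_shift_itv.
  have xT' := oc x xT; have tT' := oc t tT.
  have Shx := SwB _ _ hxT xT'.
  have [S1 S2] := (SwB _ _ hxT tT', SwB _ _ xT' tT').
  rewrite mulr0 !subr0 addrK (NE _ S1) (NE _ S2) (NE _ (semi_innerZ Sb h^-1 Shx)).
  rewrite (seminormZ Sb _ Shx) mulrA -normrM mulfV// normr1 mul1r.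
  apply: le_trans (seminormB Sb S1 S2) _.
  by rewrite opprB addrA subrK.
by rewrite subrr NE ?(seminorm0 Sb)//; rewrite -(subrr (w t)); apply: SwB; exact: oc.
Unshelve. all: by end_near. Qed.

(** * Energies *)

Section energy.
Variables (R : realType) (d : nat) (Omega Gamma0 Gamma1 : set 'rV[R]_d.+1).
Hypotheses (oO : open Omega) (bO : bounded_set Omega).
Hypotheses (Gamma0_bdry : Gamma0 `<=` bdry Omega)
  (Gamma1_bdry : Gamma1 `<=` bdry Omega)
  (mGamma1 : measurable (Gamma1 : set (caratheodory_type (surface_outer R d.+1)))).
Variables (eta alpha lam mu : R).
Hypotheses (alpha_ge0 : 0 <= alpha) (Cpos : elast_positive d.+1 lam mu).

Let Leb := Lebesgue R d.+1.
Let mO : measurable (Omega : set (caratheodory_type (leb_outer R d.+1))) :=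
  leb_open oO.
Let dot := @L2dot R _ _ Leb Omega d.+1 d.+1.
Let LS : semi_inner _ dot := L2dot_semi_inner Leb mO d.+1 d.+1.
Let Cd := @Cdot R d.+1 lam mu _ _ Leb Omega.
Let CS : semi_inner _ Cd := Cdot_semi_inner Leb mO Cpos.

Lemma energyE f q (v : vfield R d.+1) (p : 'rV[R]_d.+1 -> 'M[R]_d.+1) :
  L2 Leb Omega v.2 -> L2 Leb Omega p ->
  energy lam mu alpha Omega Gamma1 f q v p =
    2^-1 * Cd (strain v - p) (strain v - p) + alpha / 2 * dot p p
      - load Omega Gamma1 f q v.
Proof.
move=> Lv Lp; have Ls : L2 Leb Omega (strain v - p).
  exact: (semi_innerB LS (L2_strain mO Lv) Lp).
have CE := seminorm_sqr CS Ls; have pE := seminorm_sqr LS Lp.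
by rewrite -CE -pE.
Qed.

Variables (f q : 'rV[R]_d.+1 -> 'rV[R]_d.+1) (g u : vfield R d.+1).
Variables (p dp : 'rV[R]_d.+1 -> 'M[R]_d.+1).
Hypotheses (Lf : L2 Leb Omega f) (Lq : L2 (Surface R d.+1) Gamma1 q).
Hypotheses (Hg : H1 Omega g) (Vu : Vspace Omega Gamma0 g u).
Hypotheses (Lp : L2 Leb Omega p) (Ldp : L2 Leb Omega dp).
Hypothesis weak : forall w, Vspace Omega Gamma0 0 w ->
  L2dot Leb Omega (stress lam mu u p) (strain w) = load Omega Gamma1 f q w.
Hypothesis flow : eq_ae_on Leb Omega (eta *: dp + alpha *: p - stress lam mu u p) 0.

Let E v p' := energy lam mu alpha Omega Gamma1 f q v p'.

(** The flow rule tested with [r]. It holds only a.e., so it enters through invariance of the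
    pairing. *)
Lemma dot_stress r : L2 Leb Omega r ->
  Cd (strain u - p) r = eta * dot dp r + alpha * dot p r.
Proof.
move=> Lr; have [[_ Lu _] _] := Vu.
have Ls : L2 Leb Omega (stress lam mu u p).
  exact: (L2_C_act lam mu mO (semi_innerB LS (L2_strain mO Lu) Lp)).
have Lep := semi_innerZ LS eta Ldp; have Lap := semi_innerZ LS alpha Lp.
have flow' : eq_ae_on Leb Omega (stress lam mu u p) (eta *: dp + alpha *: p).
  apply: ae_imply flow => x /[apply] fx; exact/esym/subr0_eq.
apply: etrans (L2dot_ae mO Ls (semi_innerD LS Lep Lap) Lr Lr flow' (eq_ae_on_refl _ _ _)) _.
apply: etrans (semi_inner_addl LS Lep Lap Lr) _.
exact: congr2 (semi_inner_scalel LS eta Ldp Lr) (semi_inner_scalel LS alpha Lp Lr).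
Qed.

(* The first-order terms in [v - u] cancel by the weak equation. *)
Lemma energy_expansion v p' : Vspace Omega Gamma0 g v -> L2 Leb Omega p' ->
  E v p' = E u p - eta * dot dp (p' - p)
    + 2^-1 * Cd (strain (v - u) - (p' - p)) (strain (v - u) - (p' - p))
    + alpha / 2 * dot (p' - p) (p' - p).
Proof.
move=> Vv Lp'; have [Hu [tu [_ [ut _ _]]]] := Vu; have [Hv [tv [_ [vt _ _]]]] := Vv.
have [_ Lu _] := Hu; have [_ Lv _] := Hv.
have Vw := Vspace_sub oO bO Gamma0_bdry Hg Vv Vu.
have [[_ Lw _] _] := Vw.
have loadE := load_sub oO bO Gamma1_bdry mGamma1 Lf Lq Hv Hu vt ut.
have Ld := semi_innerB LS Lp' Lp.
have Lsu := L2_strain mO Lu; have Lsv := L2_strain mO Lv; have Lsw := L2_strain mO Lw.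
have La := semi_innerB LS Lsu Lp.
have Lx := semi_innerB LS Lsw Ld.
rewrite /E (energyE _ _ Lv Lp') (energyE _ _ Lu Lp).
have -> : strain v - p' = (strain u - p) + (strain (v - u) - (p' - p)).
  by rewrite strain_sub opprB addrACA [strain u + _]addrC subrK addKr.
rewrite (semi_inner_sqrD CS La Lx).
have -> : dot p' p' = dot p p + 2 * dot p (p' - p) + dot (p' - p) (p' - p).
  by rewrite -(semi_inner_sqrD LS Lp Ld) addrC subrK.
(* The weak equation at [v - u] turns the strain part of the cross term into a difference of loads,
   which replaces the load of [v] by that of [u]. *)
have wE := weak Vw; rewrite loadE in wE.
have -> : Cd (strain u - p) (strain (v - u) - (p' - p)) =
  load Omega Gamma1 f q v - load Omega Gamma1 f q u - Cd (strain u - p) (p' - p).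
  by rewrite (semi_inner_subr CS Lsw Ld La) -wE.
(* [D] is given by the flow rule; its [alpha] part cancels the cross term of the [alpha / 2]
   energy. *)
have expand (A X D PP PD DD lu lv c : R) : D = eta * c + alpha * PD ->
    2^-1 * (A + 2 * (lv - lu - D) + X) + alpha / 2 * (PP + 2 * PD + DD) - lv =
    2^-1 * A + alpha / 2 * PP - lu - eta * c + 2^-1 * X + alpha / 2 * DD.
  by move=> ->; field.
exact: expand (dot_stress Ld).
Qed.

Let Est := reduced_energy lam mu alpha Omega Gamma0 Gamma1 f q g.

Lemma reduced_energy_bounds psi h : L2 Leb Omega psi ->
  E u p - h * (eta * dot dp psi) <= Est (p + h *: psi) <=
  E u p - h * (eta * dot dp psi)
    + h ^+ 2 * (2^-1 * Cd psi psi + alpha / 2 * dot psi psi).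
Proof.
move=> Lpsi; have Lhp := semi_innerZ LS h Lpsi.
have Lp' := semi_innerD LS Lp Lhp.
have pE : p + h *: psi - p = h *: psi by rewrite addrAC subrr add0r.
have dE : eta * dot dp (h *: psi) = h * (eta * dot dp psi).
  by rewrite (semi_inner_scaler LS h Lpsi Ldp) mulrCA.
have lower v : Vspace Omega Gamma0 g v ->
    E u p - h * (eta * dot dp psi) <= E v (p + h *: psi).
  move=> Vv; have [[_ Lw _] _] := Vspace_sub oO bO Gamma0_bdry Hg Vv Vu.
  rewrite (energy_expansion Vv Lp') pE dE -[leRHS]addrA lerDl.
  apply: addr_ge0; apply: mulr_ge0; rewrite ?divr_ge0 ?invr_ge0//.
    exact: (semi_inner_ge0 CS (semi_innerB CS (L2_strain mO Lw) Lhp)).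
  exact: (semi_inner_ge0 LS Lhp).
apply/andP; split.
  (* [inf] is meaningful only on a nonempty set bounded below: [u] provides an element and [lower]
     the bound, here and for the upper estimate. *)
  apply: lb_le_inf; first by exists (E u (p + h *: psi)); exists u.
  by move=> _ [v Vv <-]; exact: lower.
have -> : E u p - h * (eta * dot dp psi)
    + h ^+ 2 * (2^-1 * Cd psi psi + alpha / 2 * dot psi psi) = E u (p + h *: psi).
  rewrite (energy_expansion Vu Lp') pE dE (subrr u).
  have -> : strain (0 : vfield R d.+1) - h *: psi = - h *: psi.
    apply/funext => x; apply/matrixP => i j.
    rewrite -[LHS]/((2^-1 *: ((0 : 'M[R]_d.+1) + 0^T) - h *: psi x) i j).
    by rewrite !mxE mulNr; ring.
  rewrite (semi_inner_scalel CS (- h) Lpsi (semi_innerZ CS (- h) Lpsi)).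
  rewrite (semi_inner_scaler CS (- h) Lpsi Lpsi).
  rewrite (semi_inner_scalel LS h Lpsi Lhp) (semi_inner_scaler LS h Lpsi Lpsi).
  rewrite -[RHS]addrA; congr (_ + _); move: (Cd psi psi) (dot psi psi) => a b; ring.
apply: ge_inf; last by exists u.
by exists (E u p - h * (eta * dot dp psi)) => _ [v Vv <-]; exact: lower.
Qed.

Lemma reduced_energy_gateaux psi : L2 Leb Omega psi ->
  gateaux_derivable Est p psi /\ dot (eta *: dp) psi = - gateaux Est p psi.
Proof.
move=> Lpsi; pose K := 2^-1 * Cd psi psi + alpha / 2 * dot psi psi.
have K0 : 0 <= K.
  apply: addr_ge0; apply: mulr_ge0; rewrite ?divr_ge0 ?invr_ge0//.
    exact: (semi_inner_ge0 CS Lpsi).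
  exact: (semi_inner_ge0 LS Lpsi).
have [D DE] : is_derive (0:R) 1 (fun eps => Est (p + eps *: psi)) (- (eta * dot dp psi)).
  apply: (@is_derive_of_bound _ _ (fun h => `|h| * K)).
    apply: nearW => h; rewrite addr0.
    have -> : `|h| * (`|h| * K) = h ^+ 2 * K.
      by rewrite mulrA -expr2 real_normK ?num_real.
    (* At [h = 0] the two bounds coincide and give [Est p = E u p], that is, [u] is a minimiser. *)
    have := reduced_energy_bounds 0 Lpsi; have := reduced_energy_bounds h Lpsi.
    rewrite -/K expr0n/= !mul0r subr0 addr0 mulrN ler_norml.
    have arith (e0 x y c k : R) : 0 <= k -> e0 - c <= x <= e0 - c + k ->
        e0 <= y <= e0 -> - k <= x - y - - c <= k by lra.
    by move=> hE h0E; apply: arith hE h0E; rewrite mulr_ge0// sqr_ge0.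
  exact: (cvg_absM (cvg_cst K)).
split=> //; rewrite /gateaux derive1E DE.
exact: etrans (semi_inner_scalel LS eta Ldp Lpsi) (esym (opprK _)).
Qed.

Lemma L2norm_le_H1norm (w : vfield R d.+1) :
  L2norm Leb Omega w.2 <= H1norm Omega w.
Proof.
have n0 : 0 <= L2norm Leb Omega w.2 by exact: sqrtr_ge0.
rewrite -[leLHS](ger0_norm n0) -sqrtr_sqr ler_wsqrtr//.
by rewrite lerDr sqr_ge0.
Qed.

(** [K] bounds the tensor and is chosen before [v], [p'] and [h], so it survives the limit. The
    field [dv] serves to bound the quotient [h^-1 *: (v - u)]: [a] and [b] dominate the norms of the
    two quotients. *)
Lemma energy_increment : 0 <= eta -> exists2 K, 0 <= K &
  forall v dv p' h, h != 0 -> Vspace Omega Gamma0 g v -> H1 Omega dv ->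
    L2 Leb Omega p' ->
    let rho := L2norm Leb Omega (h^-1 *: (p' - p) - dp) in
    let a := H1norm Omega dv + H1norm Omega (h^-1 *: (v - u) - dv) in
    let b := L2norm Leb Omega dp + rho in
    `|E v p' - E u p - h * (- eta * L2norm Leb Omega dp ^+ 2)| <=
      `|h| * (eta * (L2norm Leb Omega dp * rho)
              + `|h| * (2^-1 * (K * (a + b) ^+ 2) + alpha / 2 * b ^+ 2)).
Proof.
move=> eta0; have [K K0 KP] := @Cdot_bounded R d.+1 lam mu _ _ Leb Omega mO; exists K => //.
move=> v dv p' h h0 Vv Hdv Lp'; lazy zeta.
set rho := L2norm Leb Omega (_ - dp); set a := H1norm Omega dv + _.
set b := L2norm Leb Omega dp + rho.
have [Hu _] := Vu; have [Hv _] := Vv.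
have HS := H1_semi_inner oO bO.
have Hw := semi_innerB HS Hv Hu.
(* Writing the increments as [h] times these quotients extracts [h ^+ 2] from every quadratic
   term. *)
pose wq := h^-1 *: (v - u); pose dq := h^-1 *: (p' - p).
have Hwq : H1 Omega wq := semi_innerZ HS h^-1 Hw.
have [_ Lwq _] := Hwq.
have Ldq : L2 Leb Omega dq := semi_innerZ LS h^-1 (semi_innerB LS Lp' Lp).
have dqE : p' - p = h *: dq by rewrite /dq scalerA mulfV// scale1r.
have wqE : strain (v - u) = h *: strain wq.
  have -> : v - u = h *: wq + 0 by rewrite addr0 /wq scalerA mulfV// scale1r.
  rewrite strain_linear; apply/funext => x; apply/matrixP => i j.
  rewrite -[LHS]/((h *: strain wq x + (2^-1 *: ((0 : 'M[R]_d.+1) + 0^T))) i j).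
  by rewrite -[RHS]/((h *: strain wq x) i j) !mxE addr0 mulr0 addr0.
pose xq := strain wq - dq.
have Lswq := L2_strain mO Lwq.
have Lxq : L2 Leb Omega xq := semi_innerB LS Lswq Ldq.
have b_ge : L2norm Leb Omega dq <= b.
  have := seminormD LS Ldp (semi_innerB LS Ldq Ldp).
  by rewrite [dp + _]addrC subrK.
have a_ge : H1norm Omega wq <= a.
  have Hr := semi_innerB HS Hwq Hdv.
  have := seminormD HS Hdv Hr; rewrite [dv + _]addrC subrK.
  by rewrite -(H1normE oO Hwq) -(H1normE oO Hdv) -(H1normE oO Hr).
have xq_le : L2norm Leb Omega xq <= a + b.
  have Lmdq := semi_innerZ LS (-1) Ldq.
  have := seminormD LS Lswq Lmdq; rewrite (seminormZ LS _ Ldq) normrN1 mul1r scaleN1r.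
  move=> /le_trans; apply; apply: lerD b_ge.
  apply: le_trans (L2norm_strain mO Lwq) _.
  exact: le_trans (L2norm_le_H1norm wq) a_ge.
have Cle : Cd xq xq <= K * (a + b) ^+ 2.
  apply: le_trans (KP _ Lxq) _; apply: ler_wpM2l => //.
  have x0 : 0 <= L2norm Leb Omega xq by exact: sqrtr_ge0.
  by rewrite ler_pXn2r// nnegrE (le_trans x0 xq_le).
have dle : dot dq dq <= b ^+ 2.
  rewrite -(seminorm_sqr LS Ldq).
  have x0 : 0 <= L2norm Leb Omega dq by exact: sqrtr_ge0.
  by rewrite ler_pXn2r// nnegrE (le_trans x0 b_ge).
have C0 := semi_inner_ge0 CS Lxq; have d0 := semi_inner_ge0 LS Ldq.
(* The error of replacing the quotient [dq] by the derivative [dp] in the linear term. *)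
have cs : `|dot dp (dq - dp)| <= L2norm Leb Omega dp * rho.
  exact: (Cauchy_Schwarz LS Ldp (semi_innerB LS Ldq Ldp)).
have dotE : dot dp dq = L2norm Leb Omega dp ^+ 2 + dot dp (dq - dp).
  by rewrite (seminorm_sqr LS Ldp) (semi_inner_subr LS Ldq Ldp Ldp) addrC subrK.
have xE : strain (v - u) - (p' - p) = h *: xq by rewrite wqE dqE /xq scalerBr.
have expE : E v p' = E u p - eta * (h * dot dp dq)
    + 2^-1 * (h * (h * Cd xq xq)) + alpha / 2 * (h * (h * dot dq dq)).
  rewrite (energy_expansion Vv Lp') xE dqE.
  have Lhx := semi_innerZ LS h Lxq; have Lhd := semi_innerZ LS h Ldq.
  rewrite (semi_inner_scaler LS h Ldq Ldp).
  rewrite (semi_inner_scalel CS h Lxq Lhx) (semi_inner_scaler CS h Lxq Lxq).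
  by rewrite (semi_inner_scalel LS h Ldq Lhd) (semi_inner_scaler LS h Ldq Ldq).
have -> : E v p' - E u p - h * (- eta * L2norm Leb Omega dp ^+ 2) =
    h * (- (eta * dot dp (dq - dp)) + h * (2^-1 * Cd xq xq + alpha / 2 * dot dq dq)).
  have arith (e0 n c C D : R) : e0 - eta * (h * (n + c)) + 2^-1 * (h * (h * C))
      + alpha / 2 * (h * (h * D)) - e0 - h * (- eta * n) =
      h * (- (eta * c) + h * (2^-1 * C + alpha / 2 * D)) by field.
  by rewrite expE dotE; exact: arith.
rewrite normrM ler_wpM2l// (le_trans (ler_normD _ _))// lerD//.
  by rewrite normrN normrM ger0_norm// ler_wpM2l.
rewrite normrM ler_wpM2l// ger0_norm.
  by apply: lerD; apply: ler_wpM2l; rewrite ?invr_ge0 ?divr_ge0.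
by apply: addr_ge0; apply: mulr_ge0; rewrite ?divr_ge0 ?invr_ge0.
Qed.

End energy.

Theorem theorem3p4 (R : realType) (d : nat) (T : R)
    (Omega Gamma0 Gamma1 : set 'rV[R]_d) (eta alpha lam mu : R)
    (f : R -> 'rV[R]_d -> 'rV[R]_d) (g : R -> vfield R d)
    (q : R -> 'rV[R]_d -> 'rV[R]_d) (phi0 : 'rV[R]_d -> 'M[R]_d)
    (u du : R -> vfield R d) (phi dphi : R -> 'rV[R]_d -> 'M[R]_d)
    (d23 : d = 2%N \/ d = 3%N) (T_gt0 : 0 < T)
    (Omega_lip : bounded_lipschitz_domain Omega)
    (Gamma0_open : exists2 U, open U & Gamma0 = U `&` bdry Omega)
    (Gamma0_pos : (0 < surface_outer R d Gamma0)%E)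
    (Gamma0_closure : surface_outer R d Gamma0 = surface_outer R d (closure Gamma0))
    (Gamma1_def : Gamma1 = bdry Omega `\` closure Gamma0)
    (eta_gt0 : 0 < eta) (alpha_ge0 : 0 <= alpha)
    (C_pos : elast_positive d lam mu)
    (f_C0 : C0_path (L2 (Lebesgue R d) Omega) (L2norm (Lebesgue R d) Omega) T f)
    (g_C0 : C0_path (H1 Omega) (H1norm Omega) T g)
    (q_C0 : C0_path (L2 (Surface R d) Gamma1) (L2norm (Surface R d) Gamma1) T q)
    (phi0_Psi : Psi Omega phi0)
    (f_const : time_derivative (L2norm (Lebesgue R d) Omega) T f (fun=> 0))
    (g_const : time_derivative (H1norm Omega) T g (fun=> 0))
    (q_const : time_derivative (L2norm (Surface R d) Gamma1) T q (fun=> 0))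
    (u_C1 : C1_path (H1 Omega) (H1norm Omega) T u du)
    (phi_C1 : C1_path (Psi Omega) (L2norm (Lebesgue R d) Omega) T phi dphi)
    (u_bc : forall t, t \in `]0, T[ -> Vspace Omega Gamma0 (g t) (u t))
    (phi_init : eq_ae_on (Lebesgue R d) Omega (phi 0) phi0)
    (weak_eq : forall t, t \in `]0, T[ ->
       forall v, Vspace Omega Gamma0 0 v ->
         L2dot (Lebesgue R d) Omega (stress lam mu (u t) (phi t)) (strain v) =
         load Omega Gamma1 (f t) (q t) v)
    (flow_eq : forall t, t \in `]0, T[ ->
       eq_ae_on (Lebesgue R d) Omega
         (eta *: dphi t + alpha *: phi t - stress lam mu (u t) (phi t)) 0) :
  forall t, t \in `]0, T[ ->
    (forall psi, Psi Omega psi ->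
       let Estar := reduced_energy lam mu alpha Omega Gamma0 Gamma1
                      (f t) (q t) (g t) in
       gateaux_derivable Estar (phi t) psi /\
       L2dot (Lebesgue R d) Omega (eta *: dphi t) psi =
       - gateaux Estar (phi t) psi) /\
    (let E := fun s : R =>
       energy lam mu alpha Omega Gamma1 (f s) (q s) (u s) (phi s) in
     [/\ derivable E t 1,
         derive1 E t = - eta * L2norm (Lebesgue R d) Omega (dphi t) ^+ 2
       & - eta * L2norm (Lebesgue R d) Omega (dphi t) ^+ 2 <= 0]).
Proof.
have [n dn] : exists n, d = n.+1 by case: d23 => ->; [exists 1%N|exists 2%N].
subst d; have [oO _ _ bO _] := Omega_lip.
have Gamma0_bdry : Gamma0 `<=` bdry Omega.
  by have [U _ ->] := Gamma0_open; exact: subIsetr.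
have Gamma1_bdry : Gamma1 `<=` bdry Omega by rewrite Gamma1_def => x [].
have mGamma1 : measurable (Gamma1 : set (caratheodory_type (surface_outer R n.+1))).
  rewrite Gamma1_def; apply: caratheodory_measurable_setD.
    exact: bdry_measurable.
  by apply: surface_closed; exact: closed_closure.
have mO : measurable (Omega : set (caratheodory_type (leb_outer R n.+1))).
  exact: leb_open.
have [u_C0 du_C0 u_du] := u_C1; have [phi_C0 dphi_C0 phi_dphi] := phi_C1.
have oc x : x \in `]0, T[ -> x \in `[0, T] by exact: subset_itv_oo_cc.
have SO := L2dot_semi_inner (Lebesgue R n.+1) mO 1 n.+1.
have SG := L2dot_semi_inner (Surface R n.+1) mGamma1 1 n.+1.
have SH := H1_semi_inner oO bO.
have Lf x : x \in `]0, T[ -> L2 (Lebesgue R n.+1) Omega (f x).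
  by move=> /oc /f_C0[].
have Lq x : x \in `]0, T[ -> L2 (Surface R n.+1) Gamma1 (q x).
  by move=> /oc /q_C0[].
have Hg x : x \in `]0, T[ -> H1 Omega (g x) by move=> /oc /g_C0[].
move=> t tT.
(* A vanishing time derivative makes the seminorm of [f s - f t] zero, which means equality almost
   everywhere; likewise for [q] and [g]. *)
have f_ae s : s \in `]0, T[ -> eq_ae_on (Lebesgue R n.+1) Omega (f s) (f t).
  move=> sT; have fst := time_derivative0_const SO (fun _ _ => erefl)
    (fun x xT => (f_C0 x xT).1) f_const sT tT.
  have := L2norm_eq0 mO (semi_innerB SO (Lf s sT) (Lf t tT)) fst.
  by apply: ae_imply => x /[apply] /subr0_eq.
have q_ae s : s \in `]0, T[ -> eq_ae_on (Surface R n.+1) Gamma1 (q s) (q t).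
  move=> sT; have qst := time_derivative0_const SG (fun _ _ => erefl)
    (fun x xT => (q_C0 x xT).1) q_const sT tT.
  have := L2norm_eq0 mGamma1 (semi_innerB SG (Lq s sT) (Lq t tT)) qst.
  by apply: ae_imply => x /[apply] /subr0_eq.
have g_ae s : s \in `]0, T[ -> eq_ae_on (Lebesgue R n.+1) Omega (g s).1 (g t).1.
  move=> sT; have gst := time_derivative0_const SH (@H1normE _ _ _ oO)
    (fun x xT => (g_C0 x xT).1) g_const sT tT.
  have [Lgs _ _] := Hg s sT; have [Lgt _ _] := Hg t tT.
  (* [Vspace] reads its boundary data from the first component, whose norm is dominated by the H^1
     norm. *)
  have gst1 : L2norm (Lebesgue R n.+1) Omega ((g s).1 - (g t).1) = 0.
    apply/eqP; rewrite -sqrf_eq0 eq_le sqr_ge0 andbT.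
    move/eqP: gst; rewrite sqrtr_eq0; apply: le_trans.
    by rewrite lerDl sqr_ge0.
  have := L2norm_eq0 mO (semi_innerB SO Lgs Lgt) gst1.
  by apply: ae_imply => x /[apply] /subr0_eq.
have [[Lphi _] _] := phi_C0 t (oc t tT); have [[Ldphi _] _] := dphi_C0 t (oc t tT).
split.
  move=> psi [Lpsi _]; lazy zeta.
  exact: (reduced_energy_gateaux oO bO Gamma0_bdry Gamma1_bdry mGamma1 alpha_ge0
    C_pos (Lf t tT) (Lq t tT) (Hg t tT) (u_bc t tT) Lphi Ldphi (weak_eq t tT)
    (flow_eq t tT) Lpsi).
lazy zeta; set N := L2norm (Lebesgue R n.+1) Omega (dphi t).
suff [D DE] : is_derive t 1
    (fun s => energy lam mu alpha Omega Gamma1 (f s) (q s) (u s) (phi s))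
    (- eta * N ^+ 2).
  split; [exact: D|by rewrite derive1E DE|].
  by rewrite mulNr oppr_le0 mulr_ge0 ?sqr_ge0// ltW.
have [K K0 incr] := energy_increment oO bO Gamma0_bdry Gamma1_bdry mGamma1 alpha_ge0
    C_pos (Lf t tT) (Lq t tT) (Hg t tT) (u_bc t tT) Lphi Ldphi (weak_eq t tT)
    (flow_eq t tT) (ltW eta_gt0).
pose rho h := L2norm (Lebesgue R n.+1) Omega (h^-1 *: (phi (h + t) - phi t) - dphi t).
pose sig h := H1norm Omega (h^-1 *: (u (h + t) - u t) - du t).
have rho0 : rho h @[h --> (0 : R)^'] --> (0 : R).
  have -> : rho = (fun h => L2norm (Lebesgue R n.+1) Omega
      ((h + t - t)^-1 *: (phi (h + t) - phi t) - dphi t)).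
    by apply/funext => h; rewrite (addrK t h).
  exact: within_dnbhs_shift tT (phi_dphi t (oc t tT)).
have sig0 : sig h @[h --> (0 : R)^'] --> (0 : R).
  have -> : sig = (fun h => H1norm Omega
      ((h + t - t)^-1 *: (u (h + t) - u t) - du t)).
    by apply/funext => h; rewrite (addrK t h).
  exact: within_dnbhs_shift tT (u_du t (oc t tT)).
pose M := H1norm Omega (du t).
apply: (@is_derive_of_bound _ _ (fun h => eta * (N * rho h) +
   `|h| * (2^-1 * (K * (M + sig h + (N + rho h)) ^+ 2) + alpha / 2 * (N + rho h) ^+ 2))).
  near=> h.
  have h0 : h != 0 by near: h; exact: nbhs_dnbhs_neq.
  have sT : h + t \in `]0, T[ by near: h; exact: near_shift_itv.
  have [[Lphis _] _] := phi_C0 _ (oc _ sT).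
  (* Constancy of [g] keeps the path in the affine space of time [t], so [u (h + t)] is admissible
     in the expansion there. *)
  have Vs := Vspace_ae oO bO (Hg _ sT) (Hg t tT) (g_ae _ sT) (u_bc _ sT).
  have [Hus [tus [_ [ust _ _]]]] := u_bc _ sT.
  have [Hdu _] := du_C0 t (oc t tT).
  (* The loads are frozen at time [t], since [incr] compares states under the same data. *)
  have -> :
      energy lam mu alpha Omega Gamma1 (f (h + t)) (q (h + t)) (u (h + t)) (phi (h + t)) =
            energy lam mu alpha Omega Gamma1 (f t) (q t) (u (h + t)) (phi (h + t)).
    congr (_ - _).
    exact: (load_ae oO Gamma1_bdry mGamma1 (Lf _ sT) (Lf t tT) (Lq _ sT) (Lq t tT) Hus ust
      (f_ae _ sT) (q_ae _ sT)).
  exact: (incr _ _ _ _ h0 Vs Hdu Lphis).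
have r_cvg : eta * (N * rho h) @[h --> (0 : R)^'] --> eta * (N * 0).
  by apply: cvgM; [exact: cvg_cst|apply: cvgM => //; exact: cvg_cst].
rewrite !mulr0 in r_cvg.
rewrite -[X in _ --> X]addr0; apply: cvgD; first exact: r_cvg.
have b_cvg : (N + rho h) ^+ 2 @[h --> (0 : R)^'] --> (N + 0) ^+ 2.
  by apply: cvgM; apply: cvgD => //; exact: cvg_cst.
have ab_cvg : (M + sig h + (N + rho h)) ^+ 2 @[h --> (0 : R)^'] --> (M + 0 + (N + 0)) ^+ 2.
  by apply: cvgM; apply: cvgD; apply: cvgD => //; exact: cvg_cst.
(* The bracket need only have a limit; the factor [|h|] in front makes the product vanish. *)
apply: (@cvg_absM _ _ (2^-1 * (K * (M + 0 + (N + 0)) ^+ 2) + alpha / 2 * (N + 0) ^+ 2)).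
apply: cvgD; apply: cvgM; first exact: cvg_cst.
- by apply: cvgM => //; exact: cvg_cst.
- exact: cvg_cst.
- exact: b_cvg.
Unshelve. all: by end_near. Qed.
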